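(* For all $t_A,t_B\in\mathbb{R}$, the Abel equation $$x'=t(t-t_A)x^3+(t-t_B)(t-1)x^2,\qquad t\in[0,1],$$ has at most two positive closed solutions, taking into account their multiplicities. Moreover this upper bound is sharp, i.e. there are values of $t_A,t_B$ for which the equation has two positive closed solutions.
   Context: Let $u(t,x)$ denote the solution of the equation with $u(0,x)=x$. A solution $u(t,x)$ is closed if it is defined on $[0,1]$ and $u(1,x)=x$; it is positive if $x>0$. The multiplicity of a closed solution $u(t,\tilde x)$ is the multiplicity of $\tilde x$ as a zero of the function $x\mapsto u(1,x)-x$. *)

(* Defs.v *)
From Stdlib Require Import Reals List.
From Coquelicot Require Import Coquelicot.
Open Scope R_scope.

Definition abel_rhs (tA tB t x : R) : R :=
  t * (t - tA) * x ^ 3 + (t - tB) * (t - 1) * x ^ 2.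

(* Derivative at [t] relative to [[0, T]]: one-sided at the endpoints, so the
   values of [v] outside [[0, T]] are irrelevant. *)
Definition is_derive_on (T : R) (v : R -> R) (t l : R) : Prop :=
  filterdiff v (within (fun s => 0 <= s <= T) (locally t))
    (fun h : R => scal h l).

Definition abel_solution (tA tB T x : R) (v : R -> R) : Prop :=
  v 0 = x /\
  forall t, 0 <= t <= T -> is_derive_on T v t (abel_rhs tA tB t (v t)).

Definition defined_on (tA tB T x : R) : Prop :=
  exists v, abel_solution tA tB T x v.

(* The flow u(t,x). By uniqueness of solutions the value is determined
   whenever the solution starting at [x] is defined on [[0, t]]; otherwise it
   is unspecified, so every use concerns points satisfying [defined_on]. *)
Definition abel_flow (tA tB t x : R) : R :=
  iota (fun y : R => exists v, abel_solution tA tB t x v /\ v t = y).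

Definition closed_solution (tA tB x : R) : Prop :=
  defined_on tA tB 1 x /\ abel_flow tA tB 1 x = x.

Definition positive_closed (tA tB x : R) : Prop :=
  0 < x /\ closed_solution tA tB x.

Definition zero_multiplicity (f : R -> R) (x : R) (k : nat) : Prop :=
  (forall j : nat, (j < k)%nat -> is_derive_n f j x 0) /\
  exists l : R, l <> 0 /\ is_derive_n f k x l.

(* The derivatives at a closed solution only involve [abel_flow tA tB 1] near
   that solution, where it is not junk: the set of [x] with
   [defined_on tA tB 1 x] is open. *)
Definition closed_multiplicity (tA tB x : R) (k : nat) : Prop :=
  zero_multiplicity (fun y => abel_flow tA tB 1 y - y) x k.

(* The positive closed solutions are finitely many, each of finite
   multiplicity, and their multiplicities add up to [n]. *)
Definition positive_closed_count (tA tB : R) (n : nat) : Prop :=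
  exists (s : list R) (m : R -> nat),
    NoDup s /\
    (forall x, In x s <-> positive_closed tA tB x) /\
    (forall x, In x s -> closed_multiplicity tA tB x (m x)) /\
    list_sum (map m s) = n.

(* Main.v *)
Require Import Defs.
From Stdlib Require Import Reals List.
From Stdlib Require Import Lra Lia Psatz Classical.
From Coquelicot Require Import Coquelicot.
Open Scope R_scope.

(** Write [A] and [B] for the coefficients [t (t - a)] and [(t - b) (t - 1)],
    with [a] for [tA] and [b] for [tB].  For a positive solution [x], the
    function [u = 1 / x] satisfies [u' = - A / u - B].  In this coordinate two
    solutions [u] and [v] differ by exactly
    [(v 0 - u 0) exp (int_0^t A / (u v))] ([trajectory_difference]), so the
    displacement [D y = u 1 - y] of the solution with [u 0 = y] has derivative
    [exp I - 1] with [I = int_0^1 A / u^2], and [I] in turn has derivative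
    [- 2 J] with [J = int_0^1 A E / u^3] and [E t = exp (int_0^t A / u^2)].
    A closed solution is multiple exactly when [I = 0].

    The key fact ([singular_closed_sign]) is that [J < 0] at every multiple
    closed solution.  Let [c] be the constant for which [Y = (x - c) / E] takes
    the same value at [0] and at [a]; as [E 1 = 1] and [x 1 = x 0], it takes this
    value at [1] too.  Since [Y' = x^2 (c A + B) / E], Rolle gives the quadratic
    [c A + B] one root in [(0, a)] and one in [(a, 1)].  Its leading coefficient
    [c + 1] is positive, because its value [b] at [0] is, so [Y > Y 0] on
    [(0, a)] and [Y < Y 0] on [(a, 1)].  Now [E' = A x^2 E], so [J] differs from
    [int A x^2 E^2 (Y - Y 0)] by the integral of the derivative of a function
    of [E], which vanishes; and that integrand is negative, [A] having the sign
    of [t - a].  Hence [D > 0] in a punctured neighbourhood of the starting value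
    of a multiple closed solution ([singular_bump]): such solutions have
    multiplicity two, and [D] has no local maximum with value zero
    ([no_interior_maximum]).

    A count of zeros needs a deformation in [a], in which the family is
    strictly monotone: lowering [a] lowers [u].  Suppose that [D] is positive
    somewhere between two of its zeros [p < q].  Lower [a] to the infimum of the
    values at which [D] is positive somewhere on [[p, q]].  There [D <= 0] on
    [[p, q]], with a zero, which is interior because [D] has become negative at
    [p] and [q]; this is a forbidden maximum ([no_positive_displacement]).  So
    [D <= 0] between any two zeros, which excludes a third zero in between and,
    by the sign of [D] around a multiple zero, any multiple zero among two.

    Blow-up ([u] reaching [0]) is avoided by replacing [1 / u] by
    [1 / max (u, m)].  The truncated equation is globally Lipschitz, so Picard
    iteration defines its flow on all of [[0, 1]].  In the deformation the
    truncation stays invisible: every relevant solution remains above the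
    closed solution that starts at [p] ([flow_barrier]).

    For sharpness, a solution with large [y = u 0] satisfies
    [D y = - int B - (int A) / y - (int A F) / y^2 + O (y^-3)], where [F] is the
    primitive of [B].  At [a = 2/3], [b = 1/3] the first two integrals vanish
    and the third is [- 1/540].  Taking [a] and [b] slightly smaller balances
    the three terms so that [D] changes sign twice at very large [y]. *)

(** * Mean value arguments and differential inequalities *)

(** The point [c] is interior and differentiability is only asked there, because
    the trajectories below need not be differentiable at the ends of the unit
    interval. *)
Lemma mean_value (f df : R -> R) (p q : R) :
  p < q -> (forall t, continuous f t) ->
  (forall t, p < t < q -> is_derive f t (df t)) ->
  exists c, p < c < q /\ f q - f p = df c * (q - p).
Proof.
  intros Hpq Hc Hd.
  assert (pr1 : forall c, p < c < q -> derivable_pt f c).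
  { intros c Hc'. exists (df c). apply is_derive_Reals. now apply Hd. }
  destruct (MVT f id p q pr1 (fun c _ => derivable_pt_id c) Hpq)
    as [c [Pc E]].
  - intros c _. apply continuity_pt_filterlim, Hc.
  - intros c _. apply derivable_continuous_pt, derivable_pt_id.
  - exists c. split; [exact Pc|].
    rewrite derive_pt_id in E. unfold id in E.
    rewrite Derive_Reals in E.
    pose proof (is_derive_unique f c (df c) (Hd c Pc)) as U.
    rewrite U in E. lra.
Qed.

Lemma is_derive_eq (f : R -> R) (t l l' : R) :
  is_derive f t l -> l = l' -> is_derive f t l'.
Proof. now intros H <-. Qed.

Lemma nondecreasing_of_derive (f df : R -> R) (p q : R) :
  p <= q -> (forall t, continuous f t) ->
  (forall t, p < t < q -> is_derive f t (df t)) ->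
  (forall t, p < t < q -> 0 <= df t) -> f p <= f q.
Proof.
  intros [Hpq | ->] Hc Hd Hp; [|lra].
  destruct (mean_value f df p q Hpq Hc Hd) as [c [Hc' E]].
  specialize (Hp c Hc'). nra.
Qed.

Lemma rolle (f df : R -> R) (p q : R) :
  p < q -> (forall t, continuous f t) ->
  (forall t, p < t < q -> is_derive f t (df t)) -> f p = f q ->
  exists c, p < c < q /\ df c = 0.
Proof.
  intros Hpq Hc Hd E.
  destruct (mean_value f df p q Hpq Hc Hd) as [c [Hc' E']].
  exists c. split; [exact Hc'|].
  apply Rmult_eq_reg_r with (q - p); lra.
Qed.

Lemma is_derive_sqr_min0 (x : R) :
  is_derive (fun y => Rmin y 0 ^ 2) x (2 * Rmin x 0).
Proof.
  apply is_derive_Reals. intros eps Heps.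
  exists (mkposreal _ Heps). simpl. intros h Hh Hl.
  assert (E : Rabs (Rmin (x + h) 0 ^ 2 - Rmin x 0 ^ 2 - 2 * Rmin x 0 * h) <= h ^ 2).
  { apply Rabs_le.
    unfold Rmin; destruct (Rle_dec (x + h) 0), (Rle_dec x 0); nra. }
  replace ((Rmin (x + h) 0 * (Rmin (x + h) 0 * 1) - Rmin x 0 * (Rmin x 0 * 1)) / h - 2 * Rmin x 0)
    with ((Rmin (x + h) 0 ^ 2 - Rmin x 0 ^ 2 - 2 * Rmin x 0 * h) / h) by (field; exact Hh).
  unfold Rdiv. rewrite Rabs_mult, Rabs_inv.
  apply Rle_lt_trans with (2 := Hl).
  assert (0 < Rabs h) by now apply Rabs_pos_lt.
  apply Rmult_le_reg_r with (Rabs h); [assumption|].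
  rewrite Rmult_assoc, Rinv_l, Rmult_1_r by lra.
  rewrite <- (pow2_abs h) in E. lra.
Qed.

Lemma exp_le (x y : R) : x <= y -> exp x <= exp y.
Proof. intros [H | ->]; [now apply Rlt_le, exp_increasing | lra]. Qed.

Lemma exp_affine_derive (k t : R) :
  is_derive (fun s => exp (k * s)) t (k * exp (k * t)).
Proof. auto_derive; [trivial | ring]. Qed.

Lemma continuous_exp_affine (k t : R) : continuous (fun s => exp (k * s)) t.
Proof. apply (ex_derive_continuous (fun s => exp (k * s))). eexists; apply exp_affine_derive. Qed.

(** The hypothesis reads [w' >= L w] where [w <= 0], so that the C^1 function
    [(min w 0)^2 exp (- 2 L t)] cannot increase from its initial value [0]; thus
    [w] stays nonnegative, and then [w exp (L t)] is nondecreasing. *)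
Lemma differential_inequality (w dw : R -> R) (L p q : R) :
  0 <= L -> (forall t, continuous w t) ->
  (forall t, p < t < q -> is_derive w t (dw t)) ->
  (forall t, p < t < q -> - L * Rabs (w t) <= dw t) ->
  0 <= w p -> p <= q -> w p * exp (- L * (q - p)) <= w q.
Proof.
  intros HL Hc Hd Hi H0 Hpq.
  assert (Hpos : forall t, p <= t <= q -> 0 <= w t).
  { intros t Ht.
    assert (M : - (Rmin (w p) 0 ^ 2 * exp (- (2 * L) * p)) <=
                - (Rmin (w t) 0 ^ 2 * exp (- (2 * L) * t))).
    { apply (nondecreasing_of_derive
        (fun s => - (Rmin (w s) 0 ^ 2 * exp (- (2 * L) * s)))
        (fun s => - ((2 * Rmin (w s) 0 * dw s) * exp (- (2 * L) * s)
                   + Rmin (w s) 0 ^ 2 * (- (2 * L) * exp (- (2 * L) * s))))).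
      - lra.
      - intros s. apply (continuous_opp (fun s => Rmin (w s) 0 ^ 2 * exp (- (2 * L) * s))).
        apply (continuous_mult (fun s => Rmin (w s) 0 ^ 2) (fun s => exp (- (2 * L) * s))).
        + apply (continuous_comp w (fun y => Rmin y 0 ^ 2)); [apply Hc|].
          apply (ex_derive_continuous (fun y => Rmin y 0 ^ 2)).
          eexists; apply is_derive_sqr_min0.
        + apply continuous_exp_affine.
      - intros s Hs.
        apply (is_derive_opp (fun s => Rmin (w s) 0 ^ 2 * exp (- (2 * L) * s))).
        apply (is_derive_mult (fun s => Rmin (w s) 0 ^ 2) (fun s => exp (- (2 * L) * s))).
        + replace (2 * Rmin (w s) 0 * dw s) with (scal (dw s) (2 * Rmin (w s) 0))
            by (unfold scal; simpl; unfold mult; simpl; ring).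
          apply (is_derive_comp (fun y => Rmin y 0 ^ 2) w).
          * apply is_derive_sqr_min0.
          * apply Hd; lra.
        + apply exp_affine_derive.
        + intros; apply Rmult_comm.
      - intros s Hs.
        assert (Hs' : p < s < q) by lra.
        specialize (Hi s Hs').
        pose proof (exp_pos (- (2 * L) * s)).
        assert (Rmin (w s) 0 * dw s <= L * Rmin (w s) 0 ^ 2).
        { unfold Rmin; destruct (Rle_dec (w s) 0) as [Hn|Hn].
          - rewrite Rabs_left1 in Hi by assumption. nra.
          - lra. }
        nra. }
    rewrite (Rmin_right (w p)) in M by assumption.
    pose proof (exp_pos (- (2 * L) * t)).
    unfold Rmin in M; destruct (Rle_dec (w t) 0); [|lra].
    assert (w t ^ 2 <= 0) by nra. nra. }
  assert (M : w p * exp (L * p) <= w q * exp (L * q)).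
  { apply (nondecreasing_of_derive (fun s => w s * exp (L * s))
      (fun s => dw s * exp (L * s) + w s * (L * exp (L * s)))); auto.
    - intros s. apply (continuous_mult w (fun s => exp (L * s))); [apply Hc|].
      apply continuous_exp_affine.
    - intros s Hs. apply (is_derive_mult w (fun s => exp (L * s))).
      + now apply Hd.
      + apply exp_affine_derive.
      + intros; apply Rmult_comm.
    - intros s Hs. specialize (Hi s Hs).
      rewrite Rabs_pos_eq in Hi by (apply Hpos; lra).
      pose proof (exp_pos (L * s)). nra. }
  replace (- L * (q - p)) with (L * p + - (L * q)) by ring.
  rewrite exp_plus, exp_Ropp.
  pose proof (exp_pos (L * q)).
  apply Rmult_le_reg_r with (exp (L * q)); [assumption|].
  replace (w p * (exp (L * p) * / exp (L * q)) * exp (L * q))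
    with (w p * exp (L * p)) by (field; lra). exact M.
Qed.

Lemma strict_differential_inequality (w dw : R -> R) (L p q : R) :
  0 <= L -> (forall t, continuous w t) ->
  (forall t, p < t < q -> is_derive w t (dw t)) ->
  (forall t, p < t < q -> - L * Rabs (w t) < dw t) ->
  0 <= w p -> p < q -> 0 < w q.
Proof.
  intros HL Hc Hd Hi H0 Hpq.
  assert (Hpos : forall t, p <= t <= q -> 0 <= w t).
  { intros t Ht.
    eapply Rle_trans; [|apply (differential_inequality w dw L p t); auto; try lra].
    - apply Rmult_le_pos; [exact H0 | apply Rlt_le, exp_pos].
    - intros; apply Hd; lra.
    - intros; apply Rlt_le, Hi; lra. }
  destruct (Rle_lt_or_eq_dec 0 (w q)) as [|E]; [apply Hpos; lra|assumption|exfalso].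
  (* w q is at least a positive multiple of each earlier value w t, so a
     vanishing final value forces w to vanish throughout *)
  assert (Z : forall t, p <= t <= q -> w t = 0).
  { intros t Ht.
    assert (w t * exp (- L * (q - t)) <= w q).
    { apply (differential_inequality w dw L t q); auto; try lra.
      - intros; apply Hd; lra.
      - intros; apply Rlt_le, Hi; lra. }
    pose proof (exp_pos (- L * (q - t))). specialize (Hpos t Ht). nra. }
  destruct (rolle w dw p q Hpq Hc Hd) as [c [Hc' Ec]].
  { rewrite !Z; lra. }
  specialize (Hi c Hc'). rewrite Ec, (Z c) in Hi by lra.
  rewrite Rabs_R0 in Hi. lra.
Qed.

(** Because [2 w w' <= (2 L + 1) w^2 + eps^2], the function
    [eps^2 t - w^2 exp (- (2 L + 1) t)] is nondecreasing. *)
Lemma gronwall (w dw : R -> R) (L eps t : R) :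
  0 <= L -> 0 <= eps -> (forall t, continuous w t) ->
  (forall t, 0 < t < 1 -> is_derive w t (dw t)) ->
  (forall t, 0 < t < 1 -> Rabs (dw t) <= L * Rabs (w t) + eps) ->
  0 <= t <= 1 -> Rabs (w t) <= (Rabs (w 0) + eps) * exp (2 * L + 1).
Proof.
  intros HL He Hc Hd Hi Ht.
  set (k := 2 * L + 1).
  assert (M : eps ^ 2 * 0 - w 0 ^ 2 * exp (- k * 0) <= eps ^ 2 * t - w t ^ 2 * exp (- k * t)).
  { apply (nondecreasing_of_derive (fun s => eps ^ 2 * s - w s ^ 2 * exp (- k * s))
      (fun s => eps ^ 2 - ((2 * w s * dw s) * exp (- k * s)
                           + w s ^ 2 * (- k * exp (- k * s))))).
    - lra.
    - intros s. apply (continuous_minus (fun s => eps ^ 2 * s) (fun s => w s ^ 2 * exp (- k * s))).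
      + apply (continuous_mult (fun _ => eps ^ 2) (fun s => s));
          [apply continuous_const | apply continuous_id].
      + apply (continuous_mult (fun s => w s ^ 2) (fun s => exp (- k * s))).
        * apply (continuous_comp w (fun y => y ^ 2)); [apply Hc|].
          apply (ex_derive_continuous (fun y : R => y ^ 2)). auto_derive; trivial.
        * apply continuous_exp_affine.
    - intros s Hs.
      apply (is_derive_minus (fun s => eps ^ 2 * s) (fun s => w s ^ 2 * exp (- k * s))).
      + auto_derive; [trivial|ring].
      + apply (is_derive_mult (fun s => w s ^ 2) (fun s => exp (- k * s))).
        * replace (2 * w s * dw s) with (scal (dw s) (2 * w s))
            by (unfold scal; simpl; unfold mult; simpl; ring).
          apply (is_derive_comp (fun y => y ^ 2) w).
          -- auto_derive; [trivial | ring].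
          -- apply Hd; lra.
        * apply exp_affine_derive.
        * intros; apply Rmult_comm.
    - intros s Hs.
      assert (Hs' : 0 < s < 1) by lra. specialize (Hi s Hs').
      assert (E1 : exp (- k * s) <= 1).
      { rewrite <- exp_0. destruct (Req_dec (- k * s) 0) as [->|]; [lra|].
        apply Rlt_le, exp_increasing. unfold k in *; nra. }
      pose proof (exp_pos (- k * s)) as E0.
      assert (Q : 2 * w s * dw s <= k * w s ^ 2 + eps ^ 2).
      { assert (w s * dw s <= Rabs (w s) * Rabs (dw s))
          by (rewrite <- Rabs_mult; apply Rle_abs).
        pose proof (Rabs_pos (w s)). rewrite <- (pow2_abs (w s)).
        assert (Rabs (w s) * Rabs (dw s) <= Rabs (w s) * (L * Rabs (w s) + eps))
          by (apply Rmult_le_compat_l; assumption).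
        pose proof (pow2_ge_0 (Rabs (w s) - eps)).
        unfold k. nra. }
      assert (0 <= eps ^ 2) by apply pow2_ge_0.
      assert (0 <= (k * w s ^ 2 + eps ^ 2 - 2 * w s * dw s) * exp (- k * s))
        by (apply Rmult_le_pos; lra).
      nra. }
  rewrite !Rmult_0_r, exp_0 in M.
  assert (Ek : exp (- k * t) * exp k >= 1).
  { rewrite <- exp_plus. apply Rle_ge. rewrite <- exp_0 at 1.
    destruct (Req_dec (- k * t + k) 0) as [->|]; [lra|].
    apply Rlt_le, exp_increasing. unfold k in *; nra. }
  pose proof (exp_pos k) as Pk. pose proof (exp_pos (- k * t)).
  assert (E1 : 1 <= exp k).
  { rewrite <- exp_0. apply Rlt_le, exp_increasing. unfold k; lra. }
  pose proof (Rabs_pos (w 0)).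
  apply Rsqr_incr_0_var; [|apply Rmult_le_pos; lra].
  rewrite <- Rsqr_abs. unfold Rsqr.
  assert (w t ^ 2 * exp (- k * t) <= Rabs (w 0) ^ 2 + eps ^ 2).
  { rewrite pow2_abs. nra. }
  assert (w t ^ 2 <= (Rabs (w 0) ^ 2 + eps ^ 2) * exp k).
  { apply Rle_trans with (w t ^ 2 * exp (- k * t) * exp k).
    - assert (0 <= w t ^ 2) by apply pow2_ge_0. nra.
    - apply Rmult_le_compat_r; lra. }
  assert (exp k <= exp k * exp k) by nra.
  assert (0 <= Rabs (w 0) * eps) by (apply Rmult_le_pos; lra).
  apply Rle_trans with ((Rabs (w 0) + eps) ^ 2 * exp k); nra.
Qed.

(** * Primitives *)

Lemma ex_RInt_of_continuous (f : R -> R) (p q : R) :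
  (forall t, continuous f t) -> ex_RInt f p q.
Proof. intros Hf. apply (ex_RInt_continuous f). intros; apply Hf. Qed.

Lemma primitive_derive (f : R -> R) (p t : R) :
  (forall s, continuous f s) -> is_derive (fun s => RInt f p s) t (f t).
Proof.
  intros Hf. apply (is_derive_RInt f (fun s => RInt f p s) p); [|apply Hf].
  exists (mkposreal 1 Rlt_0_1). intros s _.
  now apply (RInt_correct f), ex_RInt_of_continuous.
Qed.

Lemma primitive_continuous (f : R -> R) (p t : R) :
  (forall s, continuous f s) -> continuous (fun s => RInt f p s) t.
Proof.
  intros Hf. apply (ex_derive_continuous (fun s => RInt f p s)).
  eexists. now apply primitive_derive.
Qed.

Lemma RInt_eq_increment (f df : R -> R) (t : R) :
  0 <= t <= 1 -> (forall s, continuous f s) -> (forall s, continuous df s) ->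
  (forall s, 0 < s < 1 -> is_derive f s (df s)) ->
  f t = f 0 + RInt df 0 t.
Proof.
  intros Ht Hf Hc Hd.
  destruct (Req_dec t 0) as [->|Hn].
  { rewrite RInt_point. unfold zero; simpl; ring. }
  set (c := f t - f 0 - RInt df 0 t).
  destruct (rolle
    (fun s => f s - RInt df 0 s - s / t * c)
    (fun s => df s - df s - 1 / t * c) 0 t) as [r [_ E]].
  - lra.
  - intros s.
    apply (continuous_minus (fun s => f s - RInt df 0 s) (fun s => s / t * c)).
    + apply (continuous_minus f (fun s => RInt df 0 s)); [apply Hf|].
      now apply primitive_continuous.
    + apply (ex_derive_continuous (fun s : R => s / t * c)).
      auto_derive; trivial.
  - intros s Hs.
    apply (is_derive_minus (fun s => f s - RInt df 0 s) (fun s => s / t * c)).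
    + apply (is_derive_minus f (fun s => RInt df 0 s)).
      * apply Hd; lra.
      * now apply primitive_derive.
    + auto_derive; [trivial | field; exact Hn].
  - rewrite RInt_point. unfold c, zero; simpl. field; exact Hn.
  - assert (Z : c = 0).
    { apply Rmult_eq_reg_l with (1 / t); [lra|].
      unfold Rdiv; rewrite Rmult_1_l; now apply Rinv_neq_0_compat. }
    unfold c in Z; lra.
Qed.

Lemma RInt_abs_le (f : R -> R) (M t : R) :
  0 <= t <= 1 -> (forall s, continuous f s) ->
  (forall s, 0 <= s <= 1 -> Rabs (f s) <= M) -> Rabs (RInt f 0 t) <= M * t.
Proof.
  intros Ht Hf HM.
  replace (M * t) with ((t - 0) * M) by ring.
  apply (abs_RInt_le_const f 0 t M); [lra | now apply ex_RInt_of_continuous |].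
  intros s Hs; apply HM; lra.
Qed.

Lemma RInt_diff_le (f h : R -> R) (M t : R) :
  0 <= t <= 1 -> (forall s, continuous f s) -> (forall s, continuous h s) ->
  (forall s, 0 <= s <= 1 -> Rabs (f s - h s) <= M) ->
  Rabs (RInt f 0 t - RInt h 0 t) <= M.
Proof.
  intros Ht Hf Hh HM.
  assert (E : RInt f 0 t - RInt h 0 t = RInt (fun s => f s - h s) 0 t).
  { symmetry. apply (RInt_minus f h); now apply ex_RInt_of_continuous. }
  rewrite E.
  assert (0 <= M) by (eapply Rle_trans; [apply Rabs_pos | apply (HM 0); lra]).
  apply Rle_trans with (M * t); [|nra].
  apply (RInt_abs_le (fun s => f s - h s)); auto.
  intros s. now apply (continuous_minus f h).
Qed.

(** * Picard iteration on the unit interval *)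

(** Composing with this retraction turns functions on [[0, 1]] into functions
    that are continuous on the whole line, as the integration lemmas require. *)
Definition clamp (t : R) : R := Rmax 0 (Rmin 1 t).

Lemma clamp_range (t : R) : 0 <= clamp t <= 1.
Proof. unfold clamp, Rmax, Rmin; repeat destruct Rle_dec; lra. Qed.

Lemma clamp_id (t : R) : 0 <= t <= 1 -> clamp t = t.
Proof. intros; unfold clamp, Rmax, Rmin; repeat destruct Rle_dec; lra. Qed.

Lemma clamp_lipschitz (s t : R) : Rabs (clamp s - clamp t) <= Rabs (s - t).
Proof.
  unfold clamp, Rmax, Rmin; repeat destruct Rle_dec;
    unfold Rabs; repeat destruct Rcase_abs; lra.
Qed.

Lemma continuous_of_lipschitz (f : R -> R) (K : R) :
  (forall s t, Rabs (f s - f t) <= K * Rabs (s - t)) -> forall t, continuous f t.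
Proof.
  intros HK t. apply continuity_pt_filterlim.
  intros eps Heps.
  assert (HK0 : 0 < Rabs K + 1) by (pose proof (Rabs_pos K); lra).
  exists (eps / (Rabs K + 1)). split; [now apply Rdiv_lt_0_compat|].
  intros s [_ Hs]. simpl in *. unfold R_dist in *.
  apply Rle_lt_trans with (1 := HK s t).
  apply Rle_lt_trans with ((Rabs K + 1) * Rabs (s - t)).
  - apply Rmult_le_compat_r; [apply Rabs_pos | pose proof (Rle_abs K); lra].
  - apply Rlt_le_trans with ((Rabs K + 1) * (eps / (Rabs K + 1))).
    + now apply Rmult_lt_compat_l.
    + right; field; lra.
Qed.

Lemma continuous_clamp (t : R) : continuous clamp t.
Proof.
  apply (continuous_of_lipschitz clamp 1). intros; rewrite Rmult_1_l.
  apply clamp_lipschitz.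
Qed.

(** Continuity at the end points together with the equation in the open
    interval; one-sided derivatives at [0] and [1] follow. *)
Definition solves (g : R -> R -> R) (u : R -> R) : Prop :=
  (forall t, continuous u t) /\
  (forall t, 0 < t < 1 -> is_derive u t (g t (u t))).

Fixpoint picard_iter (g : R -> R -> R) (y : R) (n : nat) (t : R) : R :=
  match n with
  | O => y
  | S n => y + RInt (fun s => g s (picard_iter g y n s)) 0 (clamp t)
  end.

Definition picard (g : R -> R -> R) (y t : R) : R :=
  real (Lim_seq (fun n => picard_iter g y n t)).

Section Picard.
Variables (g : R -> R -> R) (K L y : R).
Hypothesis g_continuous : forall u : R -> R,
  (forall t, continuous u t) -> forall t, continuous (fun s => g s (u s)) t.
Hypothesis g_bounded : forall t u, 0 <= t <= 1 -> Rabs (g t u) <= K.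
Hypothesis g_lipschitz : forall t u v, 0 <= t <= 1 ->
  Rabs (g t u - g t v) <= L * Rabs (u - v).

Let f := picard_iter g y.

Lemma bound_nonneg : 0 <= K.
Proof. eapply Rle_trans; [apply Rabs_pos | apply (g_bounded 0 0); lra]. Qed.

Lemma lipschitz_constant_nonneg : 0 <= L.
Proof.
  pose proof (g_lipschitz 0 1 0) as H. rewrite Rminus_0_r, Rabs_R1, Rmult_1_r in H.
  eapply Rle_trans; [apply Rabs_pos | apply H; lra].
Qed.

Lemma continuous_picard_iter (n : nat) (t : R) : continuous (f n) t.
Proof.
  revert t; induction n as [|n IH]; intros t; unfold f; simpl.
  - apply continuous_const.
  - apply (continuous_plus (fun _ => y)
      (fun t => RInt (fun s => g s (picard_iter g y n s)) 0 (clamp t))).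
    + apply continuous_const.
    + apply (continuous_comp clamp (fun t => RInt (fun s => g s (picard_iter g y n s)) 0 t)).
      * apply continuous_clamp.
      * apply primitive_continuous. now apply g_continuous.
Qed.

Lemma picard_iter_lipschitz (n : nat) (s t : R) :
  Rabs (f n s - f n t) <= K * Rabs (s - t).
Proof.
  pose proof bound_nonneg.
  destruct n as [|n]; unfold f; simpl.
  - rewrite Rminus_diag, Rabs_R0. apply Rmult_le_pos; [assumption | apply Rabs_pos].
  - set (h := fun s => g s (picard_iter g y n s)).
    assert (Hh : forall t, continuous h t) by (apply g_continuous, continuous_picard_iter).
    apply Rle_trans with (K * Rabs (clamp s - clamp t)).
    2: apply Rmult_le_compat_l; [assumption | apply clamp_lipschitz].
    replace (y + RInt h 0 (clamp s) - (y + RInt h 0 (clamp t)))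
      with (RInt h 0 (clamp s) - RInt h 0 (clamp t)) by ring.
    pose proof (clamp_range s); pose proof (clamp_range t).
    assert (Key : forall p q, 0 <= p -> p <= q -> q <= 1 ->
              Rabs (RInt h 0 q - RInt h 0 p) <= K * Rabs (q - p)).
    { intros p q Hp Hpq Hq.
      rewrite <- (RInt_Chasles h 0 p q) by now apply ex_RInt_of_continuous.
      change (plus (RInt h 0 p) (RInt h p q)) with (RInt h 0 p + RInt h p q).
      replace (RInt h 0 p + RInt h p q - RInt h 0 p) with (RInt h p q) by (simpl; lra).
      rewrite (Rabs_pos_eq (q - p)), Rmult_comm by lra.
      apply (abs_RInt_le_const h p q K); [exact Hpq | now apply ex_RInt_of_continuous |].
      intros r Hr; apply g_bounded; lra. }
    destruct (Rle_dec (clamp t) (clamp s)).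
    + apply Key; lra.
    + rewrite Rabs_minus_sym, (Rabs_minus_sym (clamp s)). apply Key; lra.
Qed.

(** In the weighted norm [sup |h t| exp (- 2 L t)] the Picard operator contracts
    by the factor [1/2], whatever the size of [L]. *)
Lemma picard_iter_step (n : nat) (t : R) :
  Rabs (f (S n) t - f n t) <= K * exp (2 * L * clamp t) / 2 ^ n.
Proof.
  pose proof bound_nonneg. pose proof lipschitz_constant_nonneg.
  revert t; induction n as [|n IH]; intros t.
  - unfold f; simpl. replace (y + RInt (fun s => g s y) 0 (clamp t) - y)
      with (RInt (fun s => g s y) 0 (clamp t) : R) by (simpl; lra).
    pose proof (clamp_range t) as Ht.
    apply Rle_trans with (K * clamp t).
    + apply (RInt_abs_le (fun s => g s y)); auto.
      intros s. apply (g_continuous (fun _ => y)). intros; apply continuous_const.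
    + assert (1 <= exp (2 * L * clamp t)).
      { rewrite <- exp_0. destruct (Req_dec (2 * L * clamp t) 0) as [->|]; [lra|].
        apply Rlt_le, exp_increasing. nra. }
      unfold Rdiv; rewrite Rinv_1, Rmult_1_r. nra.
  - change (f (S (S n)) t) with (y + RInt (fun s => g s (f (S n) s)) 0 (clamp t)).
    change (f (S n) t) with (y + RInt (fun s => g s (f n s)) 0 (clamp t)).
    pose proof (clamp_range t) as Ht. set (c := clamp t) in *.
    assert (C1 : forall s, continuous (fun s => g s (f (S n) s)) s)
      by (apply g_continuous, continuous_picard_iter).
    assert (C0 : forall s, continuous (fun s => g s (f n s)) s)
      by (apply g_continuous, continuous_picard_iter).
    replace (y + RInt (fun s => g s (f (S n) s)) 0 c - (y + RInt (fun s => g s (f n s)) 0 c))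
      with (RInt (fun s => g s (f (S n) s)) 0 c - RInt (fun s => g s (f n s)) 0 c) by (simpl; lra).
    replace (RInt (fun s => g s (f (S n) s)) 0 c - RInt (fun s => g s (f n s)) 0 c)
      with (RInt (fun s => g s (f (S n) s) - g s (f n s)) 0 c).
    2: { apply (RInt_minus (fun s => g s (f (S n) s)) (fun s => g s (f n s)));
         now apply ex_RInt_of_continuous. }
    assert (P2 : 0 < 2 ^ n) by (apply pow_lt; lra).
    set (phi := fun s => K * exp (2 * L * s) / 2 ^ S n).
    set (dphi := fun s => L * (K * exp (2 * L * s) / 2 ^ n)).
    assert (Dphi : forall s, is_derive phi s (dphi s)).
    { intros s. unfold phi, dphi. auto_derive; [trivial|]. simpl; field. lra. }
    assert (Cphi : forall s, continuous phi s)
      by (intros s; apply (ex_derive_continuous phi); eexists; apply Dphi).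
    assert (Cdphi : forall s, continuous dphi s).
    { intros s; apply (ex_derive_continuous dphi). unfold dphi. auto_derive; trivial. }
    apply Rle_trans with (RInt dphi 0 c).
    + eapply Rle_trans; [apply (abs_RInt_le (fun s => g s (f (S n) s) - g s (f n s)));
        [lra | apply ex_RInt_of_continuous; intros; now apply (continuous_minus (fun s => g s (f (S n) s)))]|].
      apply RInt_le; [lra | | now apply ex_RInt_of_continuous |].
      * apply ex_RInt_of_continuous. intros s.
        apply (continuous_comp (fun s => g s (f (S n) s) - g s (f n s)) Rabs).
        -- now apply (continuous_minus (fun s => g s (f (S n) s))).
        -- apply continuous_Rabs.
      * intros s Hs. eapply Rle_trans; [apply g_lipschitz; lra|].
        unfold dphi. apply Rmult_le_compat_l; [assumption|].
        replace s with (clamp s) at 3 by (apply clamp_id; lra). apply IH.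
    + pose proof (RInt_eq_increment phi dphi c Ht Cphi Cdphi (fun s _ => Dphi s)) as E.
      assert (0 <= phi 0).
      { unfold phi. rewrite Rmult_0_r, exp_0, Rmult_1_r. apply Rdiv_le_0_compat; [assumption|].
        apply pow_lt; lra. }
      change (K * exp (2 * L * c) / 2 ^ S n) with (phi c). lra.
Qed.

Let M := K * exp (2 * L).

Lemma picard_iter_tail (n k : nat) (t : R) :
  Rabs (f (n + k) t - f n t) <= 2 * M / 2 ^ n - 2 * M / 2 ^ (n + k).
Proof.
  pose proof bound_nonneg. pose proof lipschitz_constant_nonneg.
  induction k as [|k IH].
  - rewrite Nat.add_0_r, Rminus_diag, Rminus_diag, Rabs_R0. lra.
  - rewrite Nat.add_succ_r.
    replace (f (S (n + k)) t - f n t)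
      with ((f (S (n + k)) t - f (n + k)%nat t) + (f (n + k)%nat t - f n t)) by ring.
    eapply Rle_trans; [apply Rabs_triang|].
    pose proof (picard_iter_step (n + k) t) as S1.
    assert (P2 : 0 < 2 ^ (n + k)) by (apply pow_lt; lra).
    assert (K * exp (2 * L * clamp t) / 2 ^ (n + k) <= M / 2 ^ (n + k)).
    { apply Rmult_le_compat_r; [now apply Rlt_le, Rinv_0_lt_compat|].
      apply Rmult_le_compat_l; [assumption|].
      pose proof (clamp_range t).
      destruct (Req_dec (2 * L * clamp t) (2 * L)) as [->|]; [lra|].
      apply Rlt_le, exp_increasing. nra. }
    replace (2 * M / 2 ^ S (n + k)) with (M / 2 ^ (n + k)) by (simpl; field; lra).
    replace (2 * M / 2 ^ (n + k)) with (2 * (M / 2 ^ (n + k))) in IH by (field; lra).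
    lra.
Qed.

Lemma tail_constant_nonneg : 0 <= M.
Proof. apply Rmult_le_pos; [apply bound_nonneg | apply Rlt_le, exp_pos]. Qed.

Lemma picard_iter_tail_le (n k : nat) (t : R) :
  (n <= k)%nat -> Rabs (f k t - f n t) <= 2 * M / 2 ^ n.
Proof.
  intros Hnk. replace k with (n + (k - n))%nat by lia.
  eapply Rle_trans; [apply picard_iter_tail|].
  pose proof tail_constant_nonneg.
  assert (0 <= 2 * M / 2 ^ (n + (k - n))).
  { apply Rdiv_le_0_compat; [lra | apply pow_lt; lra]. }
  lra.
Qed.

Lemma geometric_small (C eps : R) : 0 <= C -> 0 < eps -> exists n, C / 2 ^ n < eps.
Proof.
  intros HC He.
  destruct (pow_lt_1_zero (/ 2)) with (y := eps / (C + 1)) as [n Hn].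
  - rewrite Rabs_pos_eq; lra.
  - apply Rdiv_lt_0_compat; lra.
  - exists n. specialize (Hn n (le_n _)).
    rewrite pow_inv, Rabs_pos_eq in Hn
      by (apply Rlt_le, Rinv_0_lt_compat, pow_lt; lra).
    assert (0 < / 2 ^ n) by (apply Rinv_0_lt_compat, pow_lt; lra).
    apply Rle_lt_trans with ((C + 1) * / 2 ^ n).
    + unfold Rdiv. nra.
    + apply Rmult_lt_reg_r with (/ (C + 1)); [apply Rinv_0_lt_compat; lra|].
      replace ((C + 1) * / 2 ^ n * / (C + 1)) with (/ 2 ^ n).
      * exact Hn.
      * field. split; [lra|]. apply Rgt_not_eq, pow_lt; lra.
Qed.

Lemma picard_limit (t : R) : is_lim_seq (fun n => f n t) (picard g y t).
Proof.
  apply Lim_seq_correct'. apply ex_lim_seq_cauchy_corr.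
  intros eps. pose proof tail_constant_nonneg.
  destruct (geometric_small (4 * M) eps) as [N HN]; [lra | apply cond_pos |].
  exists N. intros n k Hn Hk.
  replace (f n t - f k t) with ((f n t - f N t) - (f k t - f N t)) by ring.
  eapply Rle_lt_trans; [apply Rabs_triang|]. rewrite Rabs_Ropp.
  pose proof (picard_iter_tail_le N n t Hn). pose proof (picard_iter_tail_le N k t Hk).
  replace (4 * M / 2 ^ N) with (2 * M / 2 ^ N + 2 * M / 2 ^ N) in HN
    by (field; apply Rgt_not_eq, pow_lt; lra).
  lra.
Qed.

Lemma picard_close (n : nat) (t : R) : Rabs (picard g y t - f n t) <= 2 * M / 2 ^ n.
Proof.
  apply (is_lim_seq_le_loc (fun k => Rabs (f k t - f n t)) (fun _ => 2 * M / 2 ^ n)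
    (Rabs (picard g y t - f n t)) (2 * M / 2 ^ n)).
  - exists n. intros k Hk. now apply picard_iter_tail_le.
  - apply (is_lim_seq_abs _ (picard g y t - f n t)).
    apply is_lim_seq_minus'; [apply picard_limit | apply is_lim_seq_const].
  - apply is_lim_seq_const.
Qed.

Lemma picard_lipschitz (s t : R) :
  Rabs (picard g y s - picard g y t) <= K * Rabs (s - t).
Proof.
  apply (is_lim_seq_le (fun n => Rabs (f n s - f n t)) (fun _ => K * Rabs (s - t))
    (Rabs (picard g y s - picard g y t)) (K * Rabs (s - t))).
  - intros n. apply picard_iter_lipschitz.
  - apply (is_lim_seq_abs _ (picard g y s - picard g y t)).
    apply is_lim_seq_minus'; apply picard_limit.
  - apply is_lim_seq_const.
Qed.

Lemma continuous_picard (t : R) : continuous (picard g y) t.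
Proof. apply (continuous_of_lipschitz _ K). apply picard_lipschitz. Qed.

(** Both sides are limits of the same iterates: the operator is continuous for
    uniform convergence, by the Lipschitz bound on [g]. *)
Lemma picard_integral (t : R) :
  picard g y t = y + RInt (fun s => g s (picard g y s)) 0 (clamp t).
Proof.
  set (I := RInt _ 0 _).
  destruct (Req_dec (picard g y t) (y + I)) as [|Hne]; [assumption|exfalso].
  set (e := Rabs (picard g y t - (y + I))).
  assert (He : 0 < e) by (apply Rabs_pos_lt; lra).
  pose proof tail_constant_nonneg. pose proof lipschitz_constant_nonneg.
  assert (H2 : 0 <= L * (2 * M)) by (apply Rmult_le_pos; lra).
  destruct (geometric_small (2 * M + L * (2 * M)) e) as [n Hn]; [lra | exact He |].
  assert (B1 := picard_close (S n) t).
  assert (B2 : Rabs (f (S n) t - (y + I)) <= L * (2 * M) / 2 ^ n).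
  { change (f (S n) t) with (y + RInt (fun s => g s (f n s)) 0 (clamp t)).
    replace (y + RInt (fun s => g s (f n s)) 0 (clamp t) - (y + I))
      with (RInt (fun s => g s (f n s)) 0 (clamp t) - I) by (simpl; lra).
    apply RInt_diff_le.
    - apply clamp_range.
    - apply g_continuous, continuous_picard_iter.
    - apply g_continuous, continuous_picard.
    - intros s Hs. eapply Rle_trans; [now apply g_lipschitz|].
      unfold Rdiv. rewrite Rmult_assoc. apply Rmult_le_compat_l; [assumption|].
      rewrite Rabs_minus_sym. apply picard_close. }
  assert (P2 : 0 < 2 ^ n) by (apply pow_lt; lra).
  assert (B3 : 2 * M / 2 ^ S n <= 2 * M / 2 ^ n).
  { simpl. unfold Rdiv. apply Rmult_le_compat_l; [lra|]. apply Rinv_le_contravar; lra. }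
  assert (e <= 2 * M / 2 ^ n + L * (2 * M) / 2 ^ n).
  { unfold e. replace (picard g y t - (y + I))
      with ((picard g y t - f (S n) t) + (f (S n) t - (y + I))) by ring.
    eapply Rle_trans; [apply Rabs_triang|]. lra. }
  replace ((2 * M + L * (2 * M)) / 2 ^ n) with (2 * M / 2 ^ n + L * (2 * M) / 2 ^ n)
    in Hn by (field; lra).
  lra.
Qed.

Lemma picard_initial : picard g y 0 = y.
Proof.
  rewrite picard_integral, clamp_id, RInt_point by lra. unfold zero; simpl; ring.
Qed.

Lemma picard_clamp (t : R) : picard g y (clamp t) = picard g y t.
Proof.
  rewrite (picard_integral t), picard_integral.
  rewrite (clamp_id (clamp t)) by apply clamp_range. reflexivity.
Qed.

Lemma picard_solves : solves g (picard g y).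
Proof.
  split; [exact continuous_picard|].
  intros t Ht.
  apply (is_derive_ext_loc (fun s => y + RInt (fun r => g r (picard g y r)) 0 s)).
  - assert (Hd : 0 < Rmin t (1 - t)) by (apply Rmin_glb_lt; lra).
    exists (mkposreal _ Hd). intros s Hs.
    rewrite (picard_integral s), clamp_id; [reflexivity|].
    unfold ball in Hs; simpl in Hs; unfold AbsRing_ball, abs, minus, plus, opp in Hs; simpl in Hs.
    apply Rabs_def2 in Hs.
    pose proof (Rmin_l t (1 - t)); pose proof (Rmin_r t (1 - t)). lra.
  - replace (g t (picard g y t)) with (plus 0 (g t (picard g y t)))
      by (unfold plus; simpl; ring).
    apply (is_derive_plus (fun _ => y) (fun s => RInt (fun r => g r (picard g y r)) 0 s)).
    + apply (is_derive_const (V := R_NormedModule) y).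
    + apply (primitive_derive (fun r => g r (picard g y r))).
      apply g_continuous, continuous_picard.
Qed.

End Picard.

(** * Difference quotients and linear equations *)

(** The filter [within] collapses to a plain epsilon-delta statement because a
    point whose neighbourhoods all belong to it can only be [t]. *)
Lemma is_derive_on_iff (T : R) (v : R -> R) (t l : R) : 0 <= t <= T ->
  is_derive_on T v t l <->
  (forall eps : posreal, exists d : posreal, forall s, 0 <= s <= T ->
     Rabs (s - t) < d -> Rabs (v s - v t - (s - t) * l) <= eps * Rabs (s - t)).
Proof.
  intros Ht. unfold is_derive_on. split.
  - intros [_ H] eps.
    destruct (H t) with (eps := eps) as [d Hd].
    { intros P [d Hd]. exists d. intros s Hs _. now apply Hd. }
    exists d. intros s Hs Hst. exact (Hd s Hst Hs).
  - intros H. split; [apply (is_linear_scal_l (K := R_AbsRing) (V := R_NormedModule))|].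
    intros x Hx.
    assert (E : x = t).
    { destruct (Req_dec x t) as [|Hne]; [assumption|exfalso].
      assert (Hp : 0 < Rabs (x - t)) by (apply Rabs_pos_lt; lra).
      destruct (Hx (fun s => Rabs (s - x) < Rabs (x - t))) as [d Hd].
      - exists (mkposreal _ Hp). intros s Hs. exact Hs.
      - specialize (Hd t (ball_center t d) Ht). rewrite Rabs_minus_sym in Hd. lra. }
    subst x. intros eps. destruct (H eps) as [d Hd].
    exists d. intros s Hs1 Hs2. exact (Hd s Hs2 Hs1).
Qed.

Lemma is_derive_iff (v : R -> R) (t l : R) :
  is_derive v t l <->
  (forall eps : posreal, exists d : posreal, forall s,
     Rabs (s - t) < d -> Rabs (v s - v t - (s - t) * l) <= eps * Rabs (s - t)).
Proof.
  split.
  - intros [_ H] eps.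
    destruct (H t (fun P HP => HP) eps) as [d Hd].
    exists d. intros s Hs. exact (Hd s Hs).
  - intros H. split; [apply (is_linear_scal_l (K := R_AbsRing) (V := R_NormedModule))|].
    intros x Hx. apply (is_filter_lim_locally_unique t x) in Hx. subst x.
    intros eps. destruct (H eps) as [d Hd]. exists d. exact Hd.
Qed.

Lemma linear_solution (w k : R -> R) (t : R) :
  (forall s, continuous w s) -> (forall s, continuous k s) ->
  (forall s, 0 < s < 1 -> is_derive w s (k s * w s)) ->
  0 <= t <= 1 -> w t = w 0 * exp (RInt k 0 t).
Proof.
  intros Hw Hk Hd Ht.
  assert (E : w t * exp (- RInt k 0 t) = w 0 * exp (- RInt k 0 0)).
  { destruct (Req_dec t 0) as [->|Hn]; [reflexivity|].
    destruct (mean_value (fun s => w s * exp (- RInt k 0 s)) (fun _ => 0) 0 t)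
      as [c [_ Hc]]; [lra| | |lra].
    - intros s. apply (continuous_mult w (fun s => exp (- RInt k 0 s))); [apply Hw|].
      apply (continuous_comp (fun s => - RInt k 0 s) exp).
      + apply (continuous_opp (fun s => RInt k 0 s)). now apply primitive_continuous.
      + apply (ex_derive_continuous exp). auto_derive; trivial.
    - intros s Hs.
      apply is_derive_eq with ((k s * w s) * exp (- RInt k 0 s)
                               + w s * (- k s * exp (- RInt k 0 s))).
      + apply (is_derive_mult w (fun s => exp (- RInt k 0 s))).
        * apply Hd; lra.
        * apply (is_derive_comp exp (fun s => - RInt k 0 s)).
          -- auto_derive; [trivial | ring].
          -- apply (is_derive_opp (fun s => RInt k 0 s)). now apply primitive_derive.
        * intros; apply Rmult_comm.
      + simpl; ring. }
  rewrite RInt_point in E. unfold zero in E; simpl in E. rewrite Ropp_0, exp_0, Rmult_1_r in E.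
  rewrite <- E, Rmult_assoc, <- exp_plus.
  replace (- RInt k 0 t + RInt k 0 t) with 0 by (simpl; lra). rewrite exp_0; ring.
Qed.

(** * The equation for the reciprocal and its truncation *)

Definition coefA (a t : R) : R := t * (t - a).
Definition coefB (b t : R) : R := (t - b) * (t - 1).

Definition field (a b t u : R) : R := - coefA a t / u - coefB b t.
(** Agrees with [field] as long as [u >= m], and is bounded and Lipschitz
    in [u] for [t] in [[0, 1]], so its solutions do not blow up there. *)
Definition truncated_field (m a b t u : R) : R := - coefA a t / Rmax u m - coefB b t.

Lemma coefA_bound (a t : R) : 0 <= t <= 1 -> Rabs (coefA a t) <= 1 + Rabs a.
Proof.
  intros Ht. unfold coefA. rewrite Rabs_mult.
  rewrite (Rabs_pos_eq t) by lra.
  assert (Rabs (t - a) <= 1 + Rabs a).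
  { eapply Rle_trans; [apply Rabs_triang|]. rewrite Rabs_Ropp, (Rabs_pos_eq t); lra. }
  pose proof (Rabs_pos (t - a)). nra.
Qed.

Lemma coefB_bound (b t : R) : 0 <= t <= 1 -> Rabs (coefB b t) <= 1 + Rabs b.
Proof.
  intros Ht. unfold coefB. rewrite Rabs_mult.
  rewrite (Rabs_left1 (t - 1)) by lra.
  assert (Rabs (t - b) <= 1 + Rabs b).
  { eapply Rle_trans; [apply Rabs_triang|]. rewrite Rabs_Ropp, (Rabs_pos_eq t); lra. }
  pose proof (Rabs_pos (t - b)). nra.
Qed.

Lemma continuous_coefA (a t : R) : continuous (coefA a) t.
Proof. apply (ex_derive_continuous (coefA a)). unfold coefA. auto_derive; trivial. Qed.

Lemma continuous_coefB (b t : R) : continuous (coefB b) t.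
Proof. apply (ex_derive_continuous (coefB b)). unfold coefB. auto_derive; trivial. Qed.

Lemma continuous_Rinv_pos (u : R -> R) (t : R) :
  continuous u t -> 0 < u t -> continuous (fun s => / u s) t.
Proof.
  intros Hu Hp. apply (continuous_comp u Rinv); [exact Hu|].
  apply (ex_derive_continuous Rinv). auto_derive; lra.
Qed.

Lemma Rmax_pos_r (x m : R) : 0 < m -> 0 < Rmax x m.
Proof. pose proof (Rmax_r x m); lra. Qed.

Lemma continuous_Rmax (u : R -> R) (m t : R) :
  continuous u t -> continuous (fun s => Rmax (u s) m) t.
Proof.
  intros Hu. apply (continuous_comp u (fun x => Rmax x m)); [exact Hu|].
  apply (continuous_of_lipschitz (fun x => Rmax x m) 1). intros x y.
  unfold Rmax; repeat destruct Rle_dec; unfold Rabs; repeat destruct Rcase_abs; lra.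
Qed.

Lemma Rinv_Rmax_bound (m u : R) : 0 < m -> 0 < / Rmax u m <= / m.
Proof.
  intros Hm. split.
  - now apply Rinv_0_lt_compat, Rmax_pos_r.
  - apply Rinv_le_contravar; [exact Hm | apply Rmax_r].
Qed.

Lemma Rinv_Rmax_lipschitz (m u v : R) : 0 < m ->
  Rabs (/ Rmax u m - / Rmax v m) <= / m ^ 2 * Rabs (u - v).
Proof.
  intros Hm.
  pose proof (Rmax_pos_r u m Hm). pose proof (Rmax_pos_r v m Hm).
  replace (/ Rmax u m - / Rmax v m)
    with ((Rmax v m - Rmax u m) * (/ Rmax u m * / Rmax v m)) by (field; lra).
  rewrite Rabs_mult, Rmult_comm.
  pose proof (Rinv_Rmax_bound m u Hm). pose proof (Rinv_Rmax_bound m v Hm).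
  apply Rmult_le_compat; try apply Rabs_pos.
  - rewrite Rabs_pos_eq by nra.
    replace (/ m ^ 2) with (/ m * / m) by (field; lra). nra.
  - unfold Rmax; repeat destruct Rle_dec; unfold Rabs; repeat destruct Rcase_abs; lra.
Qed.

(** A Lipschitz constant of [truncated_field m a b t] for [t] in [[0, 1]]. *)
Definition lip (m a : R) : R := (1 + Rabs a) * / m ^ 2.

Lemma lip_nonneg (m a : R) : 0 < m -> 0 <= lip m a.
Proof.
  intros Hm. apply Rmult_le_pos; [pose proof (Rabs_pos a); lra|].
  apply Rlt_le, Rinv_0_lt_compat, pow_lt, Hm.
Qed.

Lemma truncated_field_continuous (m a b : R) (u : R -> R) : 0 < m ->
  (forall t, continuous u t) ->
  forall t, continuous (fun s => truncated_field m a b s (u s)) t.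
Proof.
  intros Hm Hu t. unfold truncated_field.
  apply (continuous_minus (fun s => - coefA a s / Rmax (u s) m) (coefB b)).
  - apply (continuous_mult (fun s => - coefA a s) (fun s => / Rmax (u s) m)).
    + apply (continuous_opp (coefA a)), continuous_coefA.
    + apply (continuous_Rinv_pos (fun s => Rmax (u s) m)).
      * now apply continuous_Rmax.
      * now apply Rmax_pos_r.
  - apply continuous_coefB.
Qed.

Lemma truncated_field_bounded (m a b t u : R) : 0 < m -> 0 <= t <= 1 ->
  Rabs (truncated_field m a b t u) <= (1 + Rabs a) * / m + (1 + Rabs b).
Proof.
  intros Hm Ht. unfold truncated_field.
  eapply Rle_trans; [apply Rabs_triang|]. rewrite Rabs_Ropp.
  apply Rplus_le_compat; [|now apply coefB_bound].
  unfold Rdiv. rewrite Rabs_mult, Rabs_Ropp.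
  pose proof (Rinv_Rmax_bound m u Hm).
  apply Rmult_le_compat; try apply Rabs_pos.
  - now apply coefA_bound.
  - rewrite Rabs_pos_eq; lra.
Qed.

Lemma truncated_field_lipschitz (m a b t u v : R) : 0 < m -> 0 <= t <= 1 ->
  Rabs (truncated_field m a b t u - truncated_field m a b t v) <= lip m a * Rabs (u - v).
Proof.
  intros Hm Ht. unfold truncated_field, lip.
  replace (_ - _) with (coefA a t * (/ Rmax v m - / Rmax u m)) by (unfold Rdiv; ring).
  rewrite Rabs_mult, Rmult_assoc. apply Rmult_le_compat; try apply Rabs_pos.
  - now apply coefA_bound.
  - rewrite (Rabs_minus_sym u). now apply Rinv_Rmax_lipschitz.
Qed.

Definition flow (m a b : R) : R -> R -> R := picard (truncated_field m a b).

Section Flow.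
Variables m a b : R.
Hypothesis m_pos : 0 < m.

Lemma flow_initial (y : R) : flow m a b y 0 = y.
Proof.
  apply (picard_initial _ ((1 + Rabs a) * / m + (1 + Rabs b)) (lip m a)).
  - intros; now apply truncated_field_continuous.
  - intros; now apply truncated_field_bounded.
  - intros; now apply truncated_field_lipschitz.
Qed.

Lemma flow_solves (y : R) : solves (truncated_field m a b) (flow m a b y).
Proof.
  apply (picard_solves _ ((1 + Rabs a) * / m + (1 + Rabs b)) (lip m a)).
  - intros; now apply truncated_field_continuous.
  - intros; now apply truncated_field_bounded.
  - intros; now apply truncated_field_lipschitz.
Qed.

Lemma flow_clamp (y t : R) : flow m a b y (clamp t) = flow m a b y t.
Proof.
  apply (picard_clamp _ ((1 + Rabs a) * / m + (1 + Rabs b)) (lip m a)).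
  - intros; now apply truncated_field_continuous.
  - intros; now apply truncated_field_bounded.
  - intros; now apply truncated_field_lipschitz.
Qed.

Lemma truncated_solutions_close (u v : R -> R) (t : R) :
  solves (truncated_field m a b) u -> solves (truncated_field m a b) v ->
  0 <= t <= 1 -> Rabs (u t - v t) <= Rabs (u 0 - v 0) * exp (2 * lip m a + 1).
Proof.
  intros [Cu Du] [Cv Dv] Ht.
  rewrite <- (Rplus_0_r (Rabs (u 0 - v 0))).
  apply (gronwall (fun s => u s - v s)
    (fun s => truncated_field m a b s (u s) - truncated_field m a b s (v s))).
  - now apply lip_nonneg.
  - lra.
  - intros s. now apply (continuous_minus u v).
  - intros s Hs. apply (is_derive_minus u v); auto.
  - intros s Hs. rewrite Rplus_0_r. apply truncated_field_lipschitz; lra.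
  - exact Ht.
Qed.

End Flow.

(** Positivity is asked at all times, also outside [[0, 1]], only to keep
    [1 / u] continuous on the whole line. *)
Definition trajectory (a b : R) (u : R -> R) : Prop :=
  (forall t, 0 < u t) /\ solves (field a b) u.

Lemma trajectory_truncated (m a b : R) (u : R -> R) :
  trajectory a b u -> (forall t, m <= u t) -> solves (truncated_field m a b) u.
Proof.
  intros [_ [Cu Du]] Hm. split; [exact Cu|].
  intros t Ht. unfold truncated_field. rewrite Rmax_left by apply Hm. now apply Du.
Qed.

Lemma trajectory_flow (m a b : R) (u : R -> R) (t : R) : 0 < m ->
  trajectory a b u -> (forall t, m <= u t) -> 0 <= t <= 1 ->
  flow m a b (u 0) t = u t.
Proof.
  intros Hm Hu Hmu Ht.
  pose proof (truncated_solutions_close m a b Hm (flow m a b (u 0)) u t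
    (flow_solves m a b Hm (u 0)) (trajectory_truncated m a b u Hu Hmu) Ht) as E.
  rewrite flow_initial, Rminus_diag, Rabs_R0, Rmult_0_l in E by exact Hm.
  pose proof (Rabs_pos (flow m a b (u 0) t - u t)).
  apply Rminus_diag_uniq. apply Rabs_eq_0. lra.
Qed.

Lemma flow_trajectory (m a b y : R) : 0 < m ->
  (forall t, m <= flow m a b y t) -> trajectory a b (flow m a b y).
Proof.
  intros Hm H. destruct (flow_solves m a b Hm y) as [C D].
  split; [intros t; specialize (H t); lra|]. split; [exact C|].
  intros t Ht. specialize (D t Ht). unfold truncated_field in D.
  rewrite Rmax_left in D by apply H. exact D.
Qed.

Lemma lower_bound_unit (u : R -> R) : (forall t, continuous u t) ->
  exists t0, 0 <= t0 <= 1 /\ forall t, 0 <= t <= 1 -> u t0 <= u t.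
Proof.
  intros Hu. destruct (continuity_ab_min u 0 1) as [t0 [H1 H2]].
  - lra.
  - intros c _. apply continuity_pt_filterlim, Hu.
  - exists t0. split; auto.
Qed.

Lemma trajectory_clamp (a b : R) (u : R -> R) :
  trajectory a b u -> trajectory a b (fun t => u (clamp t)).
Proof.
  intros [Pu [Cu Du]]. split; [intros; apply Pu|]. split.
  - intros t. apply (continuous_comp clamp u); [apply continuous_clamp | apply Cu].
  - intros t Ht. rewrite clamp_id by lra.
    apply (is_derive_ext_loc u); [|now apply Du].
    assert (Hd : 0 < Rmin t (1 - t)) by (apply Rmin_glb_lt; lra).
    exists (mkposreal _ Hd). intros s Hs.
    rewrite clamp_id; [reflexivity|].
    apply Rabs_def2 in Hs. unfold minus, plus, opp in Hs; simpl in Hs.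
    pose proof (Rmin_l t (1 - t)); pose proof (Rmin_r t (1 - t)). lra.
Qed.

Lemma trajectory_lower_bound (a b : R) (u : R -> R) : trajectory a b u ->
  exists m, 0 < m /\ forall t, m < u (clamp t).
Proof.
  intros [Pu [Cu _]]. destruct (lower_bound_unit u Cu) as [t0 [_ H]].
  exists (u t0 / 2). specialize (Pu t0). split; [lra|].
  intros t. specialize (H (clamp t) (clamp_range t)). lra.
Qed.

Lemma trajectory_unique (a b : R) (u v : R -> R) (t : R) :
  trajectory a b u -> trajectory a b v -> u 0 = v 0 -> 0 <= t <= 1 -> u t = v t.
Proof.
  intros Hu Hv E Ht.
  destruct (trajectory_lower_bound a b u Hu) as [m1 [P1 M1]].
  destruct (trajectory_lower_bound a b v Hv) as [m2 [P2 M2]].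
  pose proof (Rmin_l m1 m2); pose proof (Rmin_r m1 m2).
  assert (Pm : 0 < Rmin m1 m2) by (now apply Rmin_glb_lt).
  pose proof (trajectory_flow (Rmin m1 m2) a b _ t Pm (trajectory_clamp a b u Hu)) as E1.
  pose proof (trajectory_flow (Rmin m1 m2) a b _ t Pm (trajectory_clamp a b v Hv)) as E2.
  cbv beta in E1, E2.
  rewrite (clamp_id 0), (clamp_id t) in E1 by lra.
  rewrite (clamp_id 0), (clamp_id t) in E2 by lra.
  rewrite <- E1, <- E2, E; [reflexivity | | exact Ht | | exact Ht].
  - intros s; specialize (M2 s); lra.
  - intros s; specialize (M1 s); lra.
Qed.

(** * Reciprocals of positive solutions of the Abel equation *)

Lemma abel_solution_continuous (a b x : R) (v : R -> R) :
  abel_solution a b 1 x v -> forall t, continuous (fun s => v (clamp s)) t.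
Proof.
  intros [_ H] t.
  apply continuity_pt_filterlim. intros eps Heps.
  pose proof (clamp_range t) as Ht.
  set (l := abel_rhs a b (clamp t) (v (clamp t))).
  destruct (proj1 (is_derive_on_iff 1 v (clamp t) l Ht) (H _ Ht) (mkposreal 1 Rlt_0_1)) as [d Hd].
  assert (HL : 0 < Rabs l + 1) by (pose proof (Rabs_pos l); lra).
  exists (Rmin d (eps / (Rabs l + 1) / 2)). split.
  { apply Rmin_glb_lt; [apply cond_pos|]. apply Rdiv_lt_0_compat; [|lra].
    now apply Rdiv_lt_0_compat. }
  intros s [_ Hs]. simpl in *. unfold R_dist in *.
  pose proof (clamp_lipschitz s t) as Hl.
  pose proof (Rmin_l d (eps / (Rabs l + 1) / 2)).
  pose proof (Rmin_r d (eps / (Rabs l + 1) / 2)).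
  specialize (Hd (clamp s) (clamp_range s)).
  assert (Hd' := Hd ltac:(lra)). rewrite Rmult_1_l in Hd'.
  set (q := clamp s - clamp t) in *.
  replace (v (clamp s) - v (clamp t))
    with ((v (clamp s) - v (clamp t) - q * l) + q * l) by ring.
  eapply Rle_lt_trans; [apply Rabs_triang|]. rewrite Rabs_mult.
  assert (Rabs q * (Rabs l + 1) < eps).
  { apply Rle_lt_trans with (eps / (Rabs l + 1) / 2 * (Rabs l + 1)).
    - apply Rmult_le_compat_r; lra.
    - replace (eps / (Rabs l + 1) / 2 * (Rabs l + 1)) with (eps / 2) by (field; lra). lra. }
  lra.
Qed.

Lemma abel_solution_derive (a b x : R) (v : R -> R) (t : R) :
  abel_solution a b 1 x v -> 0 < t < 1 ->
  is_derive (fun s => v (clamp s)) t (abel_rhs a b t (v (clamp t))).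
Proof.
  intros [_ H] Ht. rewrite clamp_id by lra.
  apply is_derive_iff. intros eps.
  destruct (proj1 (is_derive_on_iff 1 v t _ ltac:(lra)) (H t ltac:(lra)) eps) as [d Hd].
  assert (Hm : 0 < Rmin d (Rmin t (1 - t))).
  { repeat apply Rmin_glb_lt; [apply cond_pos | lra | lra]. }
  exists (mkposreal _ Hm). simpl. intros s Hs.
  pose proof (Rmin_l d (Rmin t (1 - t))). pose proof (Rmin_r d (Rmin t (1 - t))).
  pose proof (Rmin_l t (1 - t)). pose proof (Rmin_r t (1 - t)).
  assert (Hs' : 0 <= s <= 1).
  { assert (Hb : Rabs (s - t) < Rmin t (1 - t)) by lra. apply Rabs_def2 in Hb. lra. }
  rewrite !clamp_id by lra. apply Hd; [exact Hs' | lra].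
Qed.

(** The equation is linear in [v] with the continuous coefficient
    [A v^2 + B v], so [v] is [x] times an exponential. *)
Lemma abel_solution_pos (a b x : R) (v : R -> R) (t : R) :
  abel_solution a b 1 x v -> 0 < x -> 0 < v (clamp t).
Proof.
  intros H Hx. pose proof (abel_solution_continuous a b x v H) as C.
  set (V := fun s => v (clamp s)) in *.
  assert (E : V (clamp t) = V 0 * exp (RInt (fun s => coefA a s * (V s * V s) + coefB b s * V s) 0 (clamp t))).
  { apply linear_solution.
    - exact C.
    - intros s. apply (continuous_plus (fun s => coefA a s * (V s * V s)) (fun s => coefB b s * V s)).
      + apply (continuous_mult (coefA a) (fun s => V s * V s)); [apply continuous_coefA|].
        now apply (continuous_mult V V).
      + apply (continuous_mult (coefB b) V); [apply continuous_coefB | apply C].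
    - intros s Hs. replace (_ * V s) with (abel_rhs a b s (V s))
        by (unfold abel_rhs, coefA, coefB; ring).
      now apply (abel_solution_derive a b x v).
    - apply clamp_range. }
  unfold V in E. rewrite (clamp_id (clamp t)), (clamp_id 0) in E by (try apply clamp_range; lra).
  destruct H as [H0 _]. rewrite H0 in E. rewrite E.
  apply Rmult_lt_0_compat; [exact Hx | apply exp_pos].
Qed.

Lemma abel_solution_trajectory (a b x : R) (v : R -> R) :
  abel_solution a b 1 x v -> 0 < x -> trajectory a b (fun t => / v (clamp t)).
Proof.
  intros H Hx. pose proof (fun t => abel_solution_pos a b x v t H Hx) as P.
  split; [|split].
  - intros t. now apply Rinv_0_lt_compat.
  - intros t. apply (continuous_Rinv_pos (fun s => v (clamp s))); [|apply P].
    now apply (abel_solution_continuous a b x v).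
  - intros t Ht.
    replace (field a b t (/ v (clamp t)))
      with (- abel_rhs a b t (v (clamp t)) / v (clamp t) ^ 2).
    + apply (is_derive_inv (fun s => v (clamp s))).
      * now apply (abel_solution_derive a b x v).
      * apply Rgt_not_eq, P.
    + specialize (P t). unfold field, abel_rhs, coefA, coefB. field. lra.
Qed.

(** The differentiability at the end points comes from writing [1 / u] as
    the integral of its own, continuous, derivative. *)
Lemma trajectory_abel_solution (a b : R) (u : R -> R) :
  trajectory a b u -> abel_solution a b 1 (/ u 0) (fun t => / u t).
Proof.
  intros [Pu [Cu Du]]. split; [reflexivity|].
  intros t Ht.
  set (w := fun s => abel_rhs a b s (/ u s)).
  assert (Cv : forall s, continuous (fun s => / u s) s)
    by (intros s; now apply continuous_Rinv_pos).
  assert (Cw : forall s, continuous w s).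
  { intros s. unfold w.
    apply (continuous_ext (fun s => coefA a s * (/ u s * (/ u s * / u s)) + coefB b s * (/ u s * / u s))).
    { intros r. unfold abel_rhs, coefA, coefB; simpl; ring. }
    assert (C2 : continuous (fun s => / u s * / u s) s)
      by (apply (continuous_mult (fun s => / u s) (fun s => / u s)); apply Cv).
    apply (continuous_plus (fun s => coefA a s * (/ u s * (/ u s * / u s)))
                           (fun s => coefB b s * (/ u s * / u s))).
    - apply (continuous_mult (coefA a)); [apply continuous_coefA|].
      apply (continuous_mult (fun s => / u s)); [apply Cv | exact C2].
    - apply (continuous_mult (coefB b)); [apply continuous_coefB | exact C2]. }
  assert (E : forall s, 0 <= s <= 1 -> / u s = / u 0 + RInt w 0 s).
  { intros s Hs. apply (RInt_eq_increment (fun s => / u s) w s Hs Cv Cw).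
    intros r Hr. unfold w.
    replace (abel_rhs a b r (/ u r)) with (- field a b r (u r) / u r ^ 2).
    - apply (is_derive_inv u); [now apply Du | apply Rgt_not_eq, Pu].
    - specialize (Pu r). unfold field, abel_rhs, coefA, coefB. field. lra. }
  apply is_derive_on_iff; [exact Ht|]. intros eps.
  destruct (proj1 (is_derive_iff _ t (w t)) (primitive_derive w 0 t Cw) eps) as [d Hd].
  exists d. intros s Hs Hst. rewrite (E s Hs), (E t Ht) at 1.
  replace (/ u 0 + RInt w 0 s - (/ u 0 + RInt w 0 t)) with (RInt w 0 s - RInt w 0 t)
    by (simpl; lra).
  exact (Hd s Hst).
Qed.

Lemma abel_flow_trajectory (a b : R) (u : R -> R) :
  trajectory a b u -> abel_flow a b 1 (/ u 0) = / u 1.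
Proof.
  intros Hu. unfold abel_flow.
  assert (P0 : 0 < / u 0) by (destruct Hu as [Pu _]; now apply Rinv_0_lt_compat).
  apply (iota_unique (V := R_CompleteNormedModule)).
  - intros y [v [Hv <-]].
    pose proof (abel_solution_trajectory a b _ v Hv P0) as T.
    pose proof (trajectory_unique a b _ u 1 T Hu) as E. cbv beta in E.
    rewrite !clamp_id in E by lra. destruct Hv as [Hv _].
    rewrite <- E; [now rewrite Rinv_inv | now rewrite Hv, Rinv_inv | lra].
  - exists (fun t => / u t). split; [now apply trajectory_abel_solution | reflexivity].
Qed.

Definition closed_trajectory (a b : R) (u : R -> R) : Prop :=
  trajectory a b u /\ u 1 = u 0.

Lemma positive_closed_iff (a b x : R) :
  positive_closed a b x <->
  0 < x /\ exists u, closed_trajectory a b u /\ u 0 = / x.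
Proof.
  unfold positive_closed, closed_solution, defined_on. split.
  - intros [Hx [[v Hv] E]]. split; [exact Hx|].
    pose proof (abel_solution_trajectory a b x v Hv Hx) as T.
    assert (E0 : / v (clamp 0) = / x).
    { rewrite clamp_id by lra. destruct Hv as [-> _]. reflexivity. }
    exists (fun t => / v (clamp t)). split; [split|]; auto.
    pose proof (abel_flow_trajectory a b _ T) as F. cbv beta in F.
    rewrite E0, Rinv_inv, E in F. rewrite E0. now rewrite F, Rinv_inv.
  - intros [Hx [u [[T E1] E0]]]. split; [exact Hx|].
    assert (Ex : x = / u 0) by (rewrite E0; now rewrite Rinv_inv).
    split.
    + exists (fun t => / u t). rewrite Ex. now apply trajectory_abel_solution.
    + rewrite Ex at 1. rewrite (abel_flow_trajectory a b u T), E1. now rewrite <- Ex.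
Qed.

(** * Dependence on the initial value *)

Lemma exp_lipschitz (M x y : R) : x <= M -> y <= M ->
  Rabs (exp x - exp y) <= exp M * Rabs (x - y).
Proof.
  assert (Key : forall p q, p < q -> q <= M -> Rabs (exp q - exp p) <= exp M * Rabs (q - p)).
  { intros p q Hpq Hq.
    destruct (mean_value exp exp p q Hpq) as [c [Hc ->]].
    - intros t. apply (ex_derive_continuous exp). auto_derive; trivial.
    - intros t _. apply is_derive_exp.
    - rewrite Rabs_mult, (Rabs_pos_eq (exp c)) by apply Rlt_le, exp_pos.
      apply Rmult_le_compat_r; [apply Rabs_pos|]. apply exp_le; lra. }
  intros Hx Hy. destruct (Rtotal_order x y) as [H|[->|H]].
  - rewrite (Rabs_minus_sym (exp x)), (Rabs_minus_sym x). now apply Key.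
  - rewrite !Rminus_diag, Rabs_R0; lra.
  - now apply Key.
Qed.

(** A difference quotient whose error is linear in [z - y]; all derivatives in
    the initial value are obtained in this form. *)
Lemma is_derive_of_slope (f : R -> R) (y l C d : R) : 0 < d ->
  (forall z, Rabs (z - y) < d -> exists s, f z - f y = (z - y) * s /\
     Rabs (s - l) <= C * Rabs (z - y)) ->
  is_derive f y l.
Proof.
  intros Hd H. apply is_derive_iff. intros eps.
  assert (HC : 0 < Rabs C + 1) by (pose proof (Rabs_pos C); lra).
  assert (Hm : 0 < Rmin d (eps / (Rabs C + 1))).
  { apply Rmin_glb_lt; [exact Hd|]. apply Rdiv_lt_0_compat; [apply cond_pos | exact HC]. }
  exists (mkposreal _ Hm). simpl. intros z Hz.
  pose proof (Rmin_l d (eps / (Rabs C + 1))). pose proof (Rmin_r d (eps / (Rabs C + 1))).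
  destruct (H z ltac:(lra)) as [s [E Hs]].
  replace (f z - f y - (z - y) * l) with ((s - l) * (z - y)) by (rewrite E; ring).
  rewrite Rabs_mult. apply Rmult_le_compat_r; [apply Rabs_pos|].
  apply Rle_trans with (1 := Hs).
  apply Rle_trans with ((Rabs C + 1) * Rabs (z - y)).
  - apply Rmult_le_compat_r; [apply Rabs_pos | pose proof (Rle_abs C); lra].
  - apply Rle_trans with ((Rabs C + 1) * (eps / (Rabs C + 1))).
    + apply Rmult_le_compat_l; lra.
    + right; field; lra.
Qed.

(** For [u = v] this is the exponent of the linearised flow along [u]; with two
    different trajectories it gives their exact difference, see
    [trajectory_difference]. *)
Definition variation (a : R) (u v : R -> R) (t : R) : R :=
  RInt (fun s => coefA a s * (/ u s * / v s)) 0 t.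

(** The logarithm of the derivative of the time-one map at [y], as long as the
    trajectory avoids the truncation; a closed solution is multiple exactly when
    it vanishes. *)
Definition exponent (m a b y : R) : R := variation a (flow m a b y) (flow m a b y) 1.

Definition exponent_slope (m a b y : R) : R :=
  - 2 * RInt (fun t => coefA a t * (/ flow m a b y t) ^ 3
                       * exp (variation a (flow m a b y) (flow m a b y) t)) 0 1.

Definition displacement (m a b y : R) : R := flow m a b y 1 - y.

(** The truncation at level [m] is invisible along the closed solution that
    starts at [y]. *)
Definition closed_start (m a b y : R) : Prop :=
  (forall t, m < flow m a b y t) /\ displacement m a b y = 0.

Section Variation.
Variables a b : R.

Lemma variation_integrand_continuous (u v : R -> R) (t : R) :
  trajectory a b u -> trajectory a b v ->
  continuous (fun s => coefA a s * (/ u s * / v s)) t.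
Proof.
  intros [Pu [Cu _]] [Pv [Cv _]].
  apply (continuous_mult (coefA a) (fun s => / u s * / v s)); [apply continuous_coefA|].
  apply (continuous_mult (fun s => / u s) (fun s => / v s));
    apply continuous_Rinv_pos; auto.
Qed.

Lemma continuous_exp_variation (u v : R -> R) (t : R) :
  trajectory a b u -> trajectory a b v ->
  continuous (fun s => exp (variation a u v s)) t.
Proof.
  intros Hu Hv. apply (continuous_comp (variation a u v) exp).
  - apply primitive_continuous. intros; now apply variation_integrand_continuous.
  - apply (ex_derive_continuous exp). auto_derive; trivial.
Qed.

(** The equation being [u' = - A / u - B], the difference [w = v - u] satisfies
    the linear equation [w' = A w / (u v)] exactly, with no remainder. *)
Lemma trajectory_difference (u v : R -> R) (t : R) :
  trajectory a b u -> trajectory a b v -> 0 <= t <= 1 ->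
  v t - u t = (v 0 - u 0) * exp (variation a u v t).
Proof.
  intros Hu Hv Ht.
  apply (linear_solution (fun s => v s - u s) (fun s => coefA a s * (/ u s * / v s))).
  - intros s. destruct Hu as [_ [Cu _]], Hv as [_ [Cv _]]. now apply (continuous_minus v u).
  - intros s. now apply variation_integrand_continuous.
  - intros s Hs. destruct Hu as [Pu [_ Du]], Hv as [Pv [_ Dv]].
    apply is_derive_eq with (field a b s (v s) - field a b s (u s)).
    + apply (is_derive_minus v u); auto.
    + specialize (Pu s); specialize (Pv s). unfold field. field. lra.
  - exact Ht.
Qed.

Variable m : R.
Hypothesis m_pos : 0 < m.

Lemma variation_bound (u v : R -> R) (t : R) :
  trajectory a b u -> trajectory a b v -> (forall t, m < u t) -> (forall t, m < v t) ->
  0 <= t <= 1 -> Rabs (variation a u v t) <= lip m a.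
Proof.
  intros Hu Hv Mu Mv Ht. pose proof (lip_nonneg m a m_pos).
  apply Rle_trans with (lip m a * t); [|nra].
  apply (RInt_abs_le (fun s => coefA a s * (/ u s * / v s))); [exact Ht | |].
  - intros; now apply variation_integrand_continuous.
  - intros s Hs. unfold lip. rewrite Rabs_mult.
    apply Rmult_le_compat; try apply Rabs_pos; [now apply coefA_bound|].
    specialize (Mu s); specialize (Mv s).
    assert (0 < / u s) by (apply Rinv_0_lt_compat; lra).
    assert (0 < / v s) by (apply Rinv_0_lt_compat; lra).
    assert (/ u s <= / m) by (apply Rinv_le_contravar; lra).
    assert (/ v s <= / m) by (apply Rinv_le_contravar; lra).
    rewrite Rabs_pos_eq by nra.
    replace (/ m ^ 2) with (/ m * / m) by (field; lra). nra.
Qed.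

Lemma flow_close (y z t : R) :
  Rabs (flow m a b z t - flow m a b y t) <= exp (2 * lip m a + 1) * Rabs (z - y).
Proof.
  rewrite <- (flow_clamp m a b m_pos z), <- (flow_clamp m a b m_pos y).
  eapply Rle_trans; [apply (truncated_solutions_close m a b m_pos)|].
  - now apply flow_solves.
  - now apply flow_solves.
  - apply clamp_range.
  - rewrite !flow_initial by exact m_pos. lra.
Qed.

Lemma flow_stays_above (y : R) : (forall t, m < flow m a b y t) ->
  exists d, 0 < d /\ forall z, Rabs (z - y) < d -> forall t, m < flow m a b z t.
Proof.
  intros H.
  destruct (lower_bound_unit (flow m a b y)) as [t0 [_ Ht0]].
  { apply (flow_solves m a b m_pos y). }
  set (k := exp (2 * lip m a + 1)).
  assert (Pk : 0 < k) by apply exp_pos.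
  exists ((flow m a b y t0 - m) / k). split.
  - apply Rdiv_lt_0_compat; [specialize (H t0); lra | exact Pk].
  - intros z Hz t. pose proof (flow_close y z t) as E. fold k in E.
    assert (k * Rabs (z - y) < flow m a b y t0 - m).
    { apply Rmult_lt_reg_l with (/ k); [now apply Rinv_0_lt_compat|].
      replace (/ k * (k * Rabs (z - y))) with (Rabs (z - y)) by (field; lra).
      replace (/ k * (flow m a b y t0 - m)) with ((flow m a b y t0 - m) / k) by (field; lra).
      exact Hz. }
    specialize (Ht0 (clamp t) (clamp_range t)). rewrite flow_clamp in Ht0 by exact m_pos.
    pose proof (Rle_abs (- (flow m a b z t - flow m a b y t))) as E'.
    rewrite Rabs_Ropp in E'. lra.
Qed.

Lemma Rinv_close (y z t : R) :
  (forall t, m < flow m a b y t) -> (forall t, m < flow m a b z t) ->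
  Rabs (/ flow m a b z t - / flow m a b y t)
    <= / m ^ 2 * exp (2 * lip m a + 1) * Rabs (z - y).
Proof.
  intros Hy Hz. pose proof (Rinv_Rmax_lipschitz m (flow m a b z t) (flow m a b y t) m_pos) as E.
  rewrite !Rmax_left in E by (apply Rlt_le; auto).
  eapply Rle_trans; [apply E|]. rewrite Rmult_assoc.
  apply Rmult_le_compat_l; [|apply flow_close].
  apply Rlt_le, Rinv_0_lt_compat, pow_lt, m_pos.
Qed.

Lemma variation_close : exists C, 0 <= C /\ forall y z t,
  (forall t, m < flow m a b y t) -> (forall t, m < flow m a b z t) -> 0 <= t <= 1 ->
  Rabs (exp (variation a (flow m a b y) (flow m a b z) t)
        - exp (variation a (flow m a b y) (flow m a b y) t)) <= C * Rabs (z - y).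
Proof.
  set (C1 := / m ^ 2 * exp (2 * lip m a + 1)).
  assert (PC1 : 0 <= C1).
  { apply Rmult_le_pos; [|apply Rlt_le, exp_pos].
    apply Rlt_le, Rinv_0_lt_compat, pow_lt, m_pos. }
  pose proof (Rabs_pos a). pose proof (Rinv_0_lt_compat m m_pos).
  exists (exp (lip m a) * ((1 + Rabs a) * (/ m * C1))). split.
  { apply Rmult_le_pos; [apply Rlt_le, exp_pos|].
    apply Rmult_le_pos; [lra|]. apply Rmult_le_pos; lra. }
  intros y z t Hy Hz Ht.
  assert (Ty : trajectory a b (flow m a b y))
    by (apply flow_trajectory; [exact m_pos | intros; now apply Rlt_le]).
  assert (Tz : trajectory a b (flow m a b z))
    by (apply flow_trajectory; [exact m_pos | intros; now apply Rlt_le]).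
  eapply Rle_trans.
  - apply (exp_lipschitz (lip m a)).
    + eapply Rle_trans; [apply Rle_abs | now apply variation_bound].
    + eapply Rle_trans; [apply Rle_abs | now apply variation_bound].
  - rewrite Rmult_assoc. apply Rmult_le_compat_l; [apply Rlt_le, exp_pos|].
    apply RInt_diff_le; [exact Ht | | |].
    + intros; now apply variation_integrand_continuous.
    + intros; now apply variation_integrand_continuous.
    + intros s Hs.
      set (p := / flow m a b y s). set (q := / flow m a b z s).
      replace (coefA a s * (p * q) - coefA a s * (p * p))
        with (coefA a s * (p * (q - p))) by ring.
      rewrite !Rabs_mult, Rmult_assoc.
      apply Rmult_le_compat; [apply Rabs_pos | | now apply coefA_bound |].
      { rewrite <- Rabs_mult. apply Rabs_pos. }
      rewrite Rmult_assoc. apply Rmult_le_compat; try apply Rabs_pos.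
      * unfold p. specialize (Hy s).
        rewrite Rabs_pos_eq by (apply Rlt_le, Rinv_0_lt_compat; lra).
        apply Rinv_le_contravar; lra.
      * now apply Rinv_close.
Qed.

Lemma flow_derive (y : R) : (forall t, m < flow m a b y t) ->
  is_derive (fun z => flow m a b z 1) y (exp (exponent m a b y)).
Proof.
  intros Hy. destruct (flow_stays_above y Hy) as [d [Pd Hd]].
  destruct variation_close as [C [PC HC]].
  apply (is_derive_of_slope _ _ _ C d Pd). intros z Hz.
  specialize (Hd z Hz).
  exists (exp (variation a (flow m a b y) (flow m a b z) 1)). split.
  - replace (z - y) with (flow m a b z 0 - flow m a b y 0)
      by (rewrite !flow_initial by exact m_pos; reflexivity).
    apply trajectory_difference; [ | |lra];
      apply flow_trajectory; try exact m_pos; intros; now apply Rlt_le.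
  - apply HC; auto. lra.
Qed.

(** The difference of [A / v^2] and [A / u^2] factors through [v - u], for which
    the exact formula is available; letting [v] tend to [u] in the remaining
    factors gives [exponent_slope]. *)
Lemma exponent_derive (y : R) : (forall t, m < flow m a b y t) ->
  is_derive (exponent m a b) y (exponent_slope m a b y).
Proof.
  intros Hy. destruct (flow_stays_above y Hy) as [d [Pd Hd]].
  destruct variation_close as [C [PC HC]].
  set (C1 := / m ^ 2 * exp (2 * lip m a + 1)).
  pose proof (Rabs_pos a) as Pa. pose proof (Rinv_0_lt_compat m m_pos) as Pr.
  set (r := / m) in *.
  set (E := exp (lip m a)). assert (PE : 0 < E) by apply exp_pos.
  apply (is_derive_of_slope _ _ _ (2 * ((1 + Rabs a) * (3 * r * r * C1 * E + 2 * (r * r * r) * C))) d Pd).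
  intros z Hz. specialize (Hd z Hz). rename Hd into Hz'.
  set (U := flow m a b y) in *. set (V := flow m a b z) in *.
  assert (TU : trajectory a b U)
    by (apply flow_trajectory; [exact m_pos | intros; now apply Rlt_le]).
  assert (TV : trajectory a b V)
    by (apply flow_trajectory; [exact m_pos | intros; now apply Rlt_le]).
  assert (CU : forall t, continuous (fun s => / U s) t)
    by (intros t; destruct TU as [P [Q _]]; now apply continuous_Rinv_pos).
  assert (CV : forall t, continuous (fun s => / V s) t)
    by (intros t; destruct TV as [P [Q _]]; now apply continuous_Rinv_pos).
  set (h := fun t => coefA a t * ((/ V t + / U t) * (/ V t * / U t)) * exp (variation a U V t)).
  set (h0 := fun t => coefA a t * (/ U t) ^ 3 * exp (variation a U U t)).
  assert (Ch : forall t, continuous h t).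
  { intros t. apply (continuous_mult (fun t => coefA a t * ((/ V t + / U t) * (/ V t * / U t)))
      (fun t => exp (variation a U V t))); [|now apply continuous_exp_variation].
    apply (continuous_mult (coefA a)); [apply continuous_coefA|].
    apply (continuous_mult (fun t => / V t + / U t) (fun t => / V t * / U t)).
    - apply (continuous_plus (fun t => / V t) (fun t => / U t)); auto.
    - apply (continuous_mult (fun t => / V t) (fun t => / U t)); auto. }
  assert (Ch0 : forall t, continuous h0 t).
  { intros t. apply (continuous_mult (fun t => coefA a t * (/ U t) ^ 3)
      (fun t => exp (variation a U U t))); [|now apply continuous_exp_variation].
    apply (continuous_mult (coefA a)); [apply continuous_coefA|].
    apply (continuous_comp (fun t => / U t) (fun x => x ^ 3)); [apply CU|].
    apply (ex_derive_continuous (fun x : R => x ^ 3)). auto_derive; trivial. }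
  exists (- RInt h 0 1). split.
  - unfold exponent. fold U V. unfold variation.
    rewrite <- (RInt_minus (fun s => coefA a s * (/ V s * / V s)) (fun s => coefA a s * (/ U s * / U s)));
      try (apply ex_RInt_of_continuous; intros; apply variation_integrand_continuous; auto).
    replace ((z - y) * - RInt h 0 1) with (scal (- (z - y)) (RInt h 0 1))
      by (unfold scal; simpl; unfold mult; simpl; ring).
    rewrite <- (RInt_scal h); [|now apply ex_RInt_of_continuous].
    apply RInt_ext. intros t Ht. rewrite Rmin_left, Rmax_right in Ht by lra.
    unfold scal, minus, plus, opp; simpl; unfold mult; simpl.
    assert (D : V t - U t = (z - y) * exp (variation a U V t)).
    { rewrite (trajectory_difference U V t TU TV) by lra.
      unfold U at 1, V at 1. rewrite !flow_initial by exact m_pos. reflexivity. }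
    unfold h. specialize (Hy t); specialize (Hz' t).
    replace (- (z - y) * (coefA a t * ((/ V t + / U t) * (/ V t * / U t)) * exp (variation a U V t)))
      with (- ((z - y) * exp (variation a U V t)) * (coefA a t * ((/ V t + / U t) * (/ V t * / U t))))
      by ring.
    rewrite <- D. field. lra.
  - unfold exponent_slope. fold U. fold h0.
    replace (- RInt h 0 1 - - 2 * RInt h0 0 1) with (- (RInt h 0 1 - RInt (fun t => 2 * h0 t) 0 1)).
    2: { pose proof (RInt_scal h0 0 1 2 (ex_RInt_of_continuous h0 0 1 Ch0)) as S.
         unfold scal in S; simpl in S; unfold mult in S; simpl in S.
         rewrite S. simpl; ring. }
    rewrite Rabs_Ropp.
    apply RInt_diff_le; [lra | exact Ch | |].
    { intros t. apply (continuous_mult (fun _ => 2) h0); [apply continuous_const | apply Ch0]. }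
    intros t Ht. unfold h, h0.
    pose proof (Rinv_close y z t Hy Hz') as Q. fold U V C1 in Q.
    pose proof (HC y z t Hy Hz' Ht) as X. fold U V in X.
    pose proof (variation_bound U V t TU TV Hy Hz' Ht) as B.
    assert (BE : exp (variation a U V t) <= E).
    { apply exp_le. eapply Rle_trans; [apply Rle_abs | exact B]. }
    pose proof (exp_pos (variation a U V t)) as PX.
    set (e1 := exp (variation a U V t)) in *. set (e0 := exp (variation a U U t)) in *.
    specialize (Hy t); specialize (Hz' t).
    assert (p0 : 0 < / U t) by (apply Rinv_0_lt_compat; lra).
    assert (q0 : 0 < / V t) by (apply Rinv_0_lt_compat; lra).
    assert (p1 : / U t <= r) by (apply Rinv_le_contravar; lra).
    assert (q1 : / V t <= r) by (apply Rinv_le_contravar; lra).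
    set (p := / U t) in *. set (q := / V t) in *.
    replace (coefA a t * ((q + p) * (q * p)) * e1 - 2 * (coefA a t * p ^ 3 * e0))
      with (coefA a t * ((p * (q + 2 * p)) * (q - p) * e1 + 2 * (p * p * p) * (e1 - e0))) by ring.
    pose proof (coefA_bound a t Ht) as BA. pose proof (Rabs_pos (z - y)) as Pz.
    rewrite Rabs_mult.
    replace (2 * ((1 + Rabs a) * (3 * r * r * C1 * E + 2 * (r * r * r) * C)) * Rabs (z - y))
      with ((1 + Rabs a) * (2 * ((3 * r * r * C1 * E + 2 * (r * r * r) * C) * Rabs (z - y)))) by ring.
    apply Rmult_le_compat; try apply Rabs_pos; [exact BA|].
    eapply Rle_trans; [apply Rabs_triang|].
    rewrite !Rabs_mult. rewrite (Rabs_pos_eq p), (Rabs_pos_eq e1), (Rabs_pos_eq 2),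
      (Rabs_pos_eq (q + 2 * p)) by lra.
    assert (0 <= Rabs (q - p)) by apply Rabs_pos.
    assert (0 <= Rabs (e1 - e0)) by apply Rabs_pos.
    assert (S1 : p * (q + 2 * p) <= 3 * r * r) by nra.
    assert (S2 : p * p * p <= r * r * r).
    { assert (p * p <= r * r) by nra. nra. }
    assert (S3 : p * (q + 2 * p) * Rabs (q - p) * e1 <= (3 * r * r) * (C1 * Rabs (z - y)) * E).
    { apply Rmult_le_compat; [ | lra | | exact BE].
      - apply Rmult_le_pos; [nra | assumption].
      - apply Rmult_le_compat; [nra | assumption | exact S1 | exact Q]. }
    assert (S4 : 2 * (p * p * p) * Rabs (e1 - e0) <= 2 * (r * r * r) * (C * Rabs (z - y))).
    { apply Rmult_le_compat; [ | assumption | lra | exact X].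
      assert (0 <= p * p) by nra. nra. }
    assert (0 <= (3 * r * r) * (C1 * Rabs (z - y)) * E).
    { eapply Rle_trans; [|exact S3]. apply Rmult_le_pos; [|lra].
      apply Rmult_le_pos; [nra | assumption]. }
    assert (0 <= 2 * (r * r * r) * (C * Rabs (z - y))).
    { eapply Rle_trans; [|exact S4]. apply Rmult_le_pos; [|assumption].
      assert (0 <= p * p) by nra. nra. }
    nra.
Qed.

End Variation.

(** * The sign of the second derivative at multiple closed solutions *)

(** This is where the shape of the coefficients enters.  Below, [q] is the
    solution [1 / u] of the Abel equation and [e] the exponent, so that [J] is
    the integral of [A q^3 exp e].  The function [y = (q - c) exp (- e)] turns
    the sign of [J] into the sign of the quadratic [c A + B], whose two roots
    are separated by [a]. *)
Lemma singular_closed_sign (a b : R) (u : R -> R) :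
  closed_trajectory a b u -> variation a u u 1 = 0 ->
  RInt (fun t => coefA a t * (/ u t) ^ 3 * exp (variation a u u t)) 0 1 < 0.
Proof.
  intros [Tu Eu] Sing. pose proof Tu as [Pu [Cu Du]].
  set (q := fun t => / u t).
  assert (Pq : forall t, 0 < q t) by (intros; now apply Rinv_0_lt_compat).
  assert (Cq : forall t, continuous q t) by (intros; now apply continuous_Rinv_pos).
  assert (Dq : forall t, 0 < t < 1 ->
    is_derive q t (coefA a t * q t ^ 3 + coefB b t * q t ^ 2)).
  { intros t Ht. apply is_derive_eq with (- field a b t (u t) / u t ^ 2).
    - apply (is_derive_inv u); [now apply Du | apply Rgt_not_eq, Pu].
    - unfold field, q. specialize (Pu t). field. lra. }
  set (e := variation a u u).
  assert (De : forall t, is_derive e t (coefA a t * q t ^ 2)).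
  { intros t. apply is_derive_eq with (coefA a t * (q t * q t)); [|ring].
    apply (primitive_derive (fun s => coefA a s * (q s * q s))).
    intros s. now apply (variation_integrand_continuous a b). }
  assert (Ce : forall t, continuous e t)
    by (intros t; apply (ex_derive_continuous e); eexists; apply De).
  assert (e0 : e 0 = 0) by (unfold e, variation; rewrite RInt_point; reflexivity).
  assert (e1 : e 1 = 0) by exact Sing.
  assert (DE : forall t, is_derive (fun s => exp (e s)) t (coefA a t * q t ^ 2 * exp (e t))).
  { intros t. apply (is_derive_comp exp e); [apply is_derive_exp | apply De]. }
  assert (CE : forall t, continuous (fun s => exp (e s)) t)
    by (intros t; apply (ex_derive_continuous (fun s => exp (e s))); eexists; apply DE).
  (* e and u exp e take equal values at 0 and 1, and their derivatives are
     A / u^2 and - B exp e; so A and B vanish inside the unit interval *)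
  assert (Ha : 0 < a < 1).
  { destruct (rolle e (fun t => coefA a t * q t ^ 2) 0 1) as [t [Ht E]]; auto; try lra.
    pose proof (pow_lt (q t) 2 (Pq t)). unfold coefA in E.
    assert (t * (t - a) = 0) by nra. assert (t - a = 0) by nra. lra. }
  assert (Hb : 0 < b < 1).
  { destruct (rolle (fun t => u t * exp (e t)) (fun t => - coefB b t * exp (e t)) 0 1)
      as [t [Ht E]]; try lra.
    - intros t. now apply (continuous_mult u (fun t => exp (e t))).
    - intros t Ht.
      apply is_derive_eq with (field a b t (u t) * exp (e t)
                               + u t * (coefA a t * q t ^ 2 * exp (e t))).
      + apply (is_derive_mult u (fun t => exp (e t))); [now apply Du | apply DE |].
        intros; apply Rmult_comm.
      + unfold field, q. specialize (Pu t). field. lra.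
    - rewrite e0, e1, Eu. reflexivity.
    - pose proof (exp_pos (e t)). unfold coefB in E.
      assert ((t - b) * (t - 1) = 0) by nra. assert (t - b = 0) by nra. lra. }
  assert (Ea : exp (e a) < 1).
  { rewrite <- exp_0. apply exp_increasing.
    destruct (mean_value e (fun t => coefA a t * q t ^ 2) 0 a) as [t [Ht E]]; auto; try lra.
    rewrite e0 in E. pose proof (pow_lt (q t) 2 (Pq t)). unfold coefA in E.
    assert (t * (t - a) < 0) by nra.
    assert (t * (t - a) * q t ^ 2 < 0) by nra. nra. }
  (* c solves (q a - c) / exp (e a) = q 0 - c *)
  set (c := (q a - q 0 * exp (e a)) / (1 - exp (e a))).
  set (y := fun t => (q t - c) * exp (- e t)).
  assert (Cy : forall t, continuous y t).
  { intros t. apply (continuous_mult (fun t => q t - c) (fun t => exp (- e t))).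
    - apply (continuous_minus q (fun _ => c)); [apply Cq | apply continuous_const].
    - apply (continuous_comp (fun t => - e t) exp).
      + now apply (continuous_opp e).
      + apply (ex_derive_continuous exp). auto_derive; trivial. }
  set (dy := fun t => q t ^ 2 * (c * coefA a t + coefB b t) * exp (- e t)).
  assert (Dy : forall t, 0 < t < 1 -> is_derive y t (dy t)).
  { intros t Ht.
    apply is_derive_eq with ((coefA a t * q t ^ 3 + coefB b t * q t ^ 2 - 0) * exp (- e t)
      + (q t - c) * (- (coefA a t * q t ^ 2) * exp (- e t))).
    - apply (is_derive_mult (fun t => q t - c) (fun t => exp (- e t))).
      + apply (is_derive_minus q (fun _ => c)); [now apply Dq | apply (is_derive_const (V := R_NormedModule) c)].
      + apply (is_derive_comp exp (fun t => - e t)); [apply is_derive_exp|].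
        apply (is_derive_opp e), De.
      + intros; apply Rmult_comm.
    - unfold dy. ring. }
  assert (y0 : y 0 = q 0 - c) by (unfold y; rewrite e0, Ropp_0, exp_0; ring).
  assert (y1 : y 1 = y 0).
  { rewrite y0. unfold y. rewrite e1, Ropp_0, exp_0. unfold q at 1. rewrite Eu. unfold q; ring. }
  assert (ya : y a = y 0).
  { rewrite y0. unfold y, c. rewrite exp_Ropp. pose proof (exp_pos (e a)). field. lra. }
  assert (Zero : forall t, dy t = 0 -> c * coefA a t + coefB b t = 0).
  { intros t E. unfold dy in E. pose proof (pow_lt (q t) 2 (Pq t)). pose proof (exp_pos (- e t)).
    apply Rmult_integral in E as [E|E]; [|lra].
    apply Rmult_integral in E as [E|E]; lra. }
  destruct (rolle y dy 0 a) as [r1 [Hr1 E1]]; auto; try lra.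
  { intros; apply Dy; lra. }
  destruct (rolle y dy a 1) as [r2 [Hr2 E2]]; auto; try lra.
  { intros; apply Dy; lra. }
  apply Zero in E1. apply Zero in E2.
  assert (Sum : (c + 1) * (r1 + r2) = c * a + 1 + b).
  { unfold coefA, coefB in E1, E2. apply Rmult_eq_reg_r with (r1 - r2); [|lra]. nra. }
  assert (Q : forall t, c * coefA a t + coefB b t = (c + 1) * ((t - r1) * (t - r2))).
  { intros t.
    assert (c * coefA a t + coefB b t - (c * coefA a r1 + coefB b r1)
            = (t - r1) * ((c + 1) * (t + r1) - (c * a + 1 + b)))
      by (unfold coefA, coefB; ring).
    rewrite <- Sum in H. rewrite E1 in H. nra. }
  (* the product of the roots is b / (c + 1), and b > 0 *)
  assert (Pc : 0 < c + 1).
  { specialize (Q 0). unfold coefA, coefB in Q.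
    assert (b = (c + 1) * (r1 * r2)) by lra.
    assert (0 < r1 * r2) by nra. nra. }
  assert (Sgn : forall t, dy t = (q t ^ 2 * exp (- e t) * (c + 1)) * ((t - r1) * (t - r2)))
    by (intros t; unfold dy; rewrite Q; ring).
  assert (Wt : forall t, 0 < q t ^ 2 * exp (- e t) * (c + 1)).
  { intros t. apply Rmult_lt_0_compat; [|exact Pc].
    apply Rmult_lt_0_compat; [apply pow_lt, Pq | apply exp_pos]. }
  assert (Above : forall t, 0 < t < a -> y 0 < y t).
  { intros t Ht. destruct (Rle_dec t r1).
    - destruct (mean_value y dy 0 t) as [s [Hs E]]; auto; try lra.
      { intros; apply Dy; lra. }
      rewrite Sgn in E. specialize (Wt s).
      assert (0 < (s - r1) * (s - r2)) by nra.
      assert (0 < (q s ^ 2 * exp (- e s) * (c + 1)) * ((s - r1) * (s - r2)))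
        by now apply Rmult_lt_0_compat. nra.
    - destruct (mean_value y dy t a) as [s [Hs E]]; auto; try lra.
      { intros; apply Dy; lra. }
      rewrite Sgn in E. specialize (Wt s).
      assert (0 < - ((s - r1) * (s - r2))) by nra.
      assert (0 < (q s ^ 2 * exp (- e s) * (c + 1)) * - ((s - r1) * (s - r2)))
        by now apply Rmult_lt_0_compat. nra. }
  assert (Below : forall t, a < t < 1 -> y t < y 0).
  { intros t Ht. destruct (Rle_dec t r2).
    - destruct (mean_value y dy a t) as [s [Hs E]]; auto; try lra.
      { intros; apply Dy; lra. }
      rewrite Sgn in E. specialize (Wt s).
      assert (0 < - ((s - r1) * (s - r2))) by nra.
      assert (0 < (q s ^ 2 * exp (- e s) * (c + 1)) * - ((s - r1) * (s - r2)))
        by now apply Rmult_lt_0_compat. nra.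
    - destruct (mean_value y dy t 1) as [s [Hs E]]; auto; try lra.
      { intros; apply Dy; lra. }
      rewrite Sgn in E. specialize (Wt s).
      assert (0 < (s - r1) * (s - r2)) by nra.
      assert (0 < (q s ^ 2 * exp (- e s) * (c + 1)) * ((s - r1) * (s - r2)))
        by now apply Rmult_lt_0_compat. nra. }
  (* split q = (q - c - y 0 exp e) + (c + y 0 exp e): the first part yields h,
     and the second part integrates to a function G of exp e *)
  set (G := fun t => c * exp (e t) + y 0 / 2 * exp (e t) ^ 2).
  set (dG := fun t => coefA a t * q t ^ 2 * exp (e t) * (c + y 0 * exp (e t))).
  set (h := fun t => coefA a t * q t ^ 2 * exp (e t) ^ 2 * (y t - y 0)).
  assert (CAE : forall t, continuous (fun t => coefA a t * q t ^ 2 * exp (e t)) t).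
  { intros t. apply (continuous_mult (fun t => coefA a t * q t ^ 2) (fun t => exp (e t)));
      [|apply CE].
    apply (continuous_mult (coefA a)); [apply continuous_coefA|].
    apply (continuous_comp q (fun x => x ^ 2)); [apply Cq|].
    apply (ex_derive_continuous (fun x : R => x ^ 2)). auto_derive; trivial. }
  assert (CdG : forall t, continuous dG t).
  { intros t. apply (continuous_mult (fun t => coefA a t * q t ^ 2 * exp (e t))
      (fun t => c + y 0 * exp (e t))); [apply CAE|].
    apply (continuous_plus (fun _ => c) (fun t => y 0 * exp (e t))); [apply continuous_const|].
    apply (continuous_mult (fun _ => y 0) (fun t => exp (e t))); [apply continuous_const | apply CE]. }
  assert (Ch : forall t, continuous h t).
  { intros t. apply (continuous_ext (fun t => coefA a t * q t ^ 2 * exp (e t)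
                                              * (exp (e t) * (y t - y 0)))).
    { intros s. unfold h. simpl; ring. }
    apply (continuous_mult (fun t => coefA a t * q t ^ 2 * exp (e t))
      (fun t => exp (e t) * (y t - y 0))); [apply CAE|].
    apply (continuous_mult (fun t => exp (e t)) (fun t => y t - y 0)); [apply CE|].
    apply (continuous_minus y (fun _ => y 0)); [apply Cy | apply continuous_const]. }
  assert (DG : forall t, is_derive G t (dG t)).
  { intros t.
    apply is_derive_eq with (coefA a t * q t ^ 2 * exp (e t) * (c + y 0 / 2 * (2 * exp (e t)))).
    - apply (is_derive_comp (fun x => c * x + y 0 / 2 * x ^ 2) (fun t => exp (e t))).
      + auto_derive; [trivial | ring].
      + apply DE.
    - unfold dG. field. }
  assert (IG : RInt dG 0 1 = 0).
  { pose proof (RInt_eq_increment G dG 1) as E.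
    assert (G 1 = G 0) by (unfold G; now rewrite e0, e1).
    enough (G 1 = G 0 + RInt dG 0 1) by lra.
    apply E; auto; [lra|]. intros t. apply (ex_derive_continuous G). eexists; apply DG. }
  assert (Eq : RInt (fun t => coefA a t * (/ u t) ^ 3 * exp (variation a u u t)) 0 1
               = RInt h 0 1 + RInt dG 0 1).
  { rewrite <- (RInt_plus h dG) by (now apply ex_RInt_of_continuous).
    apply RInt_ext. intros t _. fold e. unfold h, dG, plus; simpl. fold (q t).
    assert (y t * exp (e t) = q t - c).
    { unfold y. rewrite exp_Ropp. pose proof (exp_pos (e t)). field. lra. }
    transitivity (coefA a t * (q t * q t) * exp (e t) * (y t * exp (e t) + c)).
    - rewrite H. ring.
    - ring. }
  apply Rle_lt_trans with (1 := Req_le _ _ Eq). rewrite IG.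
  pose proof (fun t => primitive_derive h 0 t Ch) as DH.
  pose proof (fun t => primitive_continuous h 0 t Ch) as CH.
  destruct (mean_value (fun t => RInt h 0 t) h 0 a) as [s [Hs I1]]; auto; try lra.
  destruct (mean_value (fun t => RInt h 0 t) h a 1) as [r [Hr I2]]; auto; try lra.
  rewrite RInt_point in I1. unfold zero in I1; simpl in I1.
  assert (N1 : h s < 0).
  { unfold h. specialize (Above s Hs).
    assert (0 < q s ^ 2 * exp (e s) ^ 2)
      by (apply Rmult_lt_0_compat; apply pow_lt; [apply Pq | apply exp_pos]).
    assert (coefA a s < 0) by (unfold coefA; nra).
    assert (0 < - coefA a s * (y s - y 0)) by (apply Rmult_lt_0_compat; lra). nra. }
  assert (N2 : h r < 0).
  { unfold h. specialize (Below r Hr).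
    assert (0 < q r ^ 2 * exp (e r) ^ 2)
      by (apply Rmult_lt_0_compat; apply pow_lt; [apply Pq | apply exp_pos]).
    assert (0 < coefA a r) by (unfold coefA; nra).
    assert (0 < coefA a r * (y 0 - y r)) by (apply Rmult_lt_0_compat; lra). nra. }
  assert (h s * (a - 0) < 0) by nra. assert (h r * (1 - a) < 0) by nra.
  simpl in *. lra.
Qed.

Section Displacement.
Variables m a b : R.
Hypothesis m_pos : 0 < m.

Lemma continuous_displacement (y : R) : continuous (displacement m a b) y.
Proof.
  apply (continuous_minus (fun y => flow m a b y 1) (fun y => y)); [|apply continuous_id].
  apply (continuous_of_lipschitz _ (exp (2 * lip m a + 1))).
  intros s t. now apply flow_close.
Qed.

Lemma displacement_derive (y : R) : (forall t, m < flow m a b y t) ->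
  is_derive (displacement m a b) y (exp (exponent m a b y) - 1).
Proof.
  intros Hy. apply (is_derive_minus (fun y => flow m a b y 1) (fun y => y)).
  - now apply flow_derive.
  - apply (is_derive_id (K := R_AbsRing)).
Qed.

Lemma flow_closed_trajectory (y : R) :
  (forall t, m < flow m a b y t) -> displacement m a b y = 0 ->
  closed_trajectory a b (flow m a b y).
Proof.
  intros Hy Z. split.
  - apply flow_trajectory; [exact m_pos|]. intros; now apply Rlt_le.
  - rewrite flow_initial by exact m_pos. unfold displacement in Z. lra.
Qed.

Lemma exponent_slope_pos (y : R) : (forall t, m < flow m a b y t) ->
  displacement m a b y = 0 -> exponent m a b y = 0 -> 0 < exponent_slope m a b y.
Proof.
  intros Hy Z Sing.
  pose proof (singular_closed_sign a b _ (flow_closed_trajectory y Hy Z) Sing).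
  unfold exponent_slope. lra.
Qed.

(** Near [y] the derivative [exp (exponent) - 1] of the displacement has the
    sign of [z - y], since the exponent vanishes at [y] with positive slope. *)
Lemma singular_bump (y : R) : (forall t, m < flow m a b y t) ->
  displacement m a b y = 0 -> exponent m a b y = 0 ->
  exists d, 0 < d /\ forall z, z <> y -> Rabs (z - y) < d -> 0 < displacement m a b z.
Proof.
  intros Hy Z Sing. pose proof (exponent_slope_pos y Hy Z Sing) as Pl.
  set (l := exponent_slope m a b y) in *.
  assert (Pl2 : 0 < l / 2) by lra.
  destruct (proj1 (is_derive_iff _ y l) (exponent_derive a b m m_pos y Hy) (mkposreal _ Pl2))
    as [d1 H1]. simpl in H1.
  destruct (flow_stays_above a b m m_pos y Hy) as [d2 [Pd2 H2]].
  exists (Rmin d1 d2). split; [apply Rmin_glb_lt; [apply cond_pos | exact Pd2]|].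
  intros z Hne Hz. pose proof (Rmin_l d1 d2). pose proof (Rmin_r d1 d2).
  assert (Near : forall s, Rabs (s - y) <= Rabs (z - y) ->
    is_derive (displacement m a b) s (exp (exponent m a b s) - 1)).
  { intros s Hs. apply displacement_derive, H2. lra. }
  assert (Sg : forall s, Rabs (s - y) <= Rabs (z - y) ->
    Rabs (exponent m a b s - (s - y) * l) <= l / 2 * Rabs (s - y)).
  { intros s Hs. specialize (H1 s ltac:(lra)). rewrite Sing, Rminus_0_r in H1. exact H1. }
  destruct (Rtotal_order z y) as [Hlt | [-> | Hgt]]; [| now contradiction Hne |].
  - destruct (mean_value (displacement m a b) (fun s => exp (exponent m a b s) - 1) z y)
      as [s [Hs E]]; [exact Hlt | apply continuous_displacement | |].
    { intros s Hs. apply Near. rewrite !Rabs_left1; lra. }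
    assert (Hs' : Rabs (s - y) <= Rabs (z - y)) by (rewrite !Rabs_left1; lra).
    specialize (Sg s Hs'). rewrite (Rabs_left1 (s - y)) in Sg by lra.
    apply Rabs_le_between in Sg.
    assert (exponent m a b s < 0) by nra.
    assert (exp (exponent m a b s) < 1) by (rewrite <- exp_0; now apply exp_increasing).
    nra.
  - destruct (mean_value (displacement m a b) (fun s => exp (exponent m a b s) - 1) y z)
      as [s [Hs E]]; [exact Hgt | apply continuous_displacement | |].
    { intros s Hs. apply Near. rewrite !Rabs_pos_eq; lra. }
    assert (Hs' : Rabs (s - y) <= Rabs (z - y)) by (rewrite !Rabs_pos_eq; lra).
    specialize (Sg s Hs'). rewrite (Rabs_pos_eq (s - y)) in Sg by lra.
    apply Rabs_le_between in Sg.
    assert (0 < exponent m a b s) by nra.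
    assert (1 < exp (exponent m a b s)) by (rewrite <- exp_0; now apply exp_increasing).
    nra.
Qed.

(** A maximum would make the closed solution multiple, but at a multiple one the
    displacement has a strict local minimum. *)
Lemma no_interior_maximum (p y q : R) : (forall t, m < flow m a b y t) ->
  p < y < q -> displacement m a b y = 0 ->
  (forall z, p <= z <= q -> displacement m a b z <= 0) -> False.
Proof.
  intros Hy Hpq Z Hmax.
  assert (Sing : exponent m a b y = 0).
  { pose proof (displacement_derive y Hy) as D.
    assert (pr : derivable_pt (displacement m a b) y).
    { exists (exp (exponent m a b y) - 1). now apply is_derive_Reals. }
    pose proof (deriv_maximum (displacement m a b) p q y pr (proj1 Hpq) (proj2 Hpq)) as E.
    rewrite Derive_Reals, (is_derive_unique _ _ _ D) in E.
    assert (E' : exp (exponent m a b y) = exp 0).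
    { rewrite exp_0. rewrite Z in E.
      enough (exp (exponent m a b y) - 1 = 0) by lra. apply E.
      intros z H1 H2. apply Hmax; lra. }
    now apply exp_inv. }
  destruct (singular_bump y Hy Z Sing) as [d [Pd Hd]].
  assert (Pm : 0 < Rmin d (q - y)) by (apply Rmin_glb_lt; lra).
  pose proof (Rmin_l d (q - y)). pose proof (Rmin_r d (q - y)).
  set (z := y + Rmin d (q - y) / 2).
  assert (0 < displacement m a b z).
  { apply Hd; unfold z; [lra|]. rewrite Rabs_pos_eq; lra. }
  specialize (Hmax z). unfold z in *. lra.
Qed.

End Displacement.

(** * Dependence on the first parameter *)

Section Rotation.
Variables m b : R.
Hypothesis m_pos : 0 < m.

Lemma truncated_field_parameter (a a' t u : R) :
  truncated_field m a' b t u = truncated_field m a b t u + (a' - a) * (t * / Rmax u m).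
Proof. unfold truncated_field, coefA, Rdiv. ring. Qed.

Lemma displacement_increasing (a a' y : R) :
  a < a' -> displacement m a b y < displacement m a' b y.
Proof.
  intros Ha. unfold displacement.
  pose proof (flow_solves m a b m_pos y) as [C D].
  pose proof (flow_solves m a' b m_pos y) as [C' D'].
  enough (0 < flow m a' b y 1 - flow m a b y 1) by lra.
  apply (strict_differential_inequality (fun t => flow m a' b y t - flow m a b y t)
    (fun t => truncated_field m a' b t (flow m a' b y t)
              - truncated_field m a b t (flow m a b y t)) (lip m a) 0 1).
  - now apply lip_nonneg.
  - intros t. now apply (continuous_minus (flow m a' b y) (flow m a b y)).
  - intros t Ht. apply (is_derive_minus (flow m a' b y) (flow m a b y)); auto.
  - intros t Ht. rewrite (truncated_field_parameter a a').
    pose proof (truncated_field_lipschitz m a b t (flow m a' b y t) (flow m a b y t)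
      m_pos ltac:(lra)) as E.
    apply Rabs_le_between in E.
    pose proof (Rinv_Rmax_bound m (flow m a' b y t) m_pos).
    assert (0 < (a' - a) * (t * / Rmax (flow m a' b y t) m)).
    { apply Rmult_lt_0_compat; [lra|]. apply Rmult_lt_0_compat; lra. }
    lra.
  - rewrite !flow_initial by exact m_pos. lra.
  - lra.
Qed.

Lemma displacement_lipschitz (a : R) : exists C, 0 < C /\ forall a' y,
  Rabs (displacement m a' b y - displacement m a b y) <= C * Rabs (a' - a).
Proof.
  pose proof (Rinv_0_lt_compat m m_pos) as Pr.
  exists (/ m * exp (2 * lip m a + 1)). split.
  { apply Rmult_lt_0_compat; [exact Pr | apply exp_pos]. }
  intros a' y. unfold displacement.
  pose proof (flow_solves m a b m_pos y) as [C D].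
  pose proof (flow_solves m a' b m_pos y) as [C' D'].
  pose proof (gronwall (fun t => flow m a' b y t - flow m a b y t)
    (fun t => truncated_field m a' b t (flow m a' b y t)
              - truncated_field m a b t (flow m a b y t))
    (lip m a) (Rabs (a' - a) * / m) 1) as E. cbv beta in E.
  rewrite !flow_initial, Rminus_diag, Rabs_R0, Rplus_0_l in E by exact m_pos.
  replace (flow m a' b y 1 - y - (flow m a b y 1 - y))
    with (flow m a' b y 1 - flow m a b y 1) by ring.
  replace (/ m * exp (2 * lip m a + 1) * Rabs (a' - a))
    with (Rabs (a' - a) * / m * exp (2 * lip m a + 1)) by ring.
  apply E.
  - now apply lip_nonneg.
  - apply Rmult_le_pos; [apply Rabs_pos | lra].
  - intros t. now apply (continuous_minus (flow m a' b y) (flow m a b y)).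
  - intros t Ht. apply (is_derive_minus (flow m a' b y) (flow m a b y)); auto.
  - intros t Ht. rewrite (truncated_field_parameter a a').
    replace (_ + _ - _) with
      ((truncated_field m a b t (flow m a' b y t) - truncated_field m a b t (flow m a b y t))
       + (a' - a) * (t * / Rmax (flow m a' b y t) m)) by ring.
    eapply Rle_trans; [apply Rabs_triang|]. apply Rplus_le_compat.
    + apply truncated_field_lipschitz; [exact m_pos | lra].
    + rewrite Rabs_mult. apply Rmult_le_compat_l; [apply Rabs_pos|].
      pose proof (Rinv_Rmax_bound m (flow m a' b y t) m_pos).
      rewrite Rabs_pos_eq; nra.
  - lra.
Qed.

(** Lowering the parameter lowers the field, so a solution that has once fallen
    below the trajectory from [y] can never catch up with it by time [1]. *)
Lemma flow_barrier (a a' y z t : R) :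
  a' <= a -> (forall s, m < flow m a b y s) ->
  flow m a b y 1 <= flow m a' b z 1 ->
  0 <= t <= 1 -> flow m a b y t <= flow m a' b z t.
Proof.
  intros Ha Hy H1 Ht. apply Rnot_lt_le. intros Hlt.
  pose proof (flow_solves m a b m_pos y) as [C D].
  pose proof (flow_solves m a' b m_pos z) as [C' D'].
  assert ((flow m a b y t - flow m a' b z t) * exp (- lip m a * (1 - t))
          <= flow m a b y 1 - flow m a' b z 1).
  { apply (differential_inequality (fun s => flow m a b y s - flow m a' b z s)
      (fun s => truncated_field m a b s (flow m a b y s)
                - truncated_field m a' b s (flow m a' b z s))).
    - now apply lip_nonneg.
    - intros s. now apply (continuous_minus (flow m a b y) (flow m a' b z)).
    - intros s Hs. apply (is_derive_minus (flow m a b y) (flow m a' b z));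
        [apply D | apply D']; lra.
    - intros s Hs. rewrite (truncated_field_parameter a a').
      pose proof (truncated_field_lipschitz m a b s (flow m a b y s) (flow m a' b z s)
        m_pos ltac:(lra)) as E.
      apply Rabs_le_between in E.
      pose proof (Rinv_Rmax_bound m (flow m a' b z s) m_pos).
      assert (0 <= (a - a') * (s * / Rmax (flow m a' b z s) m)).
      { apply Rmult_le_pos; [lra|]. apply Rmult_le_pos; lra. }
      lra.
    - lra.
    - lra. }
  pose proof (exp_pos (- lip m a * (1 - t))). nra.
Qed.

(** For very negative [a] the term [a t / max (u, m)] drives [u] down by an
    arbitrarily large amount, as [u] is bounded above independently of [a < 0]. *)
Lemma positive_displacement_parameter_bound (q : R) : exists c, forall a y,
  0 <= y <= q -> 0 < displacement m a b y -> c <= a.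
Proof.
  set (k := 1 + Rabs b). assert (Pk : 0 < k) by (pose proof (Rabs_pos b); unfold k; lra).
  set (M := Rabs q + k + m).
  assert (PM : 0 < M) by (pose proof (Rabs_pos q); unfold M; lra).
  exists (- (2 * M * k)). intros a y Hy HD.
  apply Rnot_lt_le. intros Ha.
  assert (Hneg : a < 0) by nra.
  pose proof (flow_solves m a b m_pos y) as [C D].
  set (U := flow m a b y) in *.
  assert (HB : forall s, 0 < s < 1 -> - coefB b s <= k).
  { intros s Hs. pose proof (coefB_bound b s ltac:(lra)) as E. unfold k.
    apply Rabs_le_between in E. lra. }
  assert (Up : forall t, 0 <= t <= 1 -> U t <= y + k * t).
  { intros t Ht.
    assert (k * 0 - U 0 <= k * t - U t).
    { apply (nondecreasing_of_derive (fun s => k * s - U s)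
        (fun s => k - truncated_field m a b s (U s))); [lra | | |].
      - intros s. apply (continuous_minus (fun s => k * s) U); [|apply C].
        apply (continuous_mult (fun _ => k) (fun s => s)); [apply continuous_const | apply continuous_id].
      - intros s Hs. apply (is_derive_minus (fun s => k * s) U); [|apply D; lra].
        auto_derive; [trivial | ring].
      - intros s Hs. specialize (HB s ltac:(lra)). unfold truncated_field, coefA, Rdiv.
        pose proof (Rinv_Rmax_bound m (U s) m_pos).
        assert (0 <= s * (s - a) * / Rmax (U s) m).
        { apply Rmult_le_pos; [|lra]. apply Rmult_le_pos; lra. }
        lra. }
    unfold U in H at 1. rewrite flow_initial in H by exact m_pos. lra. }
  assert (HM : forall s, 0 < s < 1 -> / M <= / Rmax (U s) m).
  { intros s Hs. apply Rinv_le_contravar; [now apply Rmax_pos_r|].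
    specialize (Up s ltac:(lra)). pose proof (Rle_abs q).
    apply Rmax_lub; unfold M; [nra|]. pose proof (Rabs_pos q). lra. }
  assert (a / (2 * M) * 0 ^ 2 + k * 0 - U 0 <= a / (2 * M) * 1 ^ 2 + k * 1 - U 1).
  { apply (nondecreasing_of_derive (fun s => a / (2 * M) * s ^ 2 + k * s - U s)
      (fun s => a / M * s + k - truncated_field m a b s (U s))); [lra | | |].
    - intros s. apply (continuous_minus (fun s => a / (2 * M) * s ^ 2 + k * s) U); [|apply C].
      apply (ex_derive_continuous (fun s : R => a / (2 * M) * s ^ 2 + k * s)). auto_derive; trivial.
    - intros s Hs.
      apply (is_derive_minus (fun s => a / (2 * M) * s ^ 2 + k * s) U); [|now apply D].
      auto_derive; [trivial | field; lra].
    - intros s Hs. specialize (HB s Hs). specialize (HM s Hs).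
      unfold truncated_field, coefA, Rdiv.
      pose proof (Rinv_0_lt_compat M PM).
      assert (0 <= s * s * / Rmax (U s) m) by (apply Rmult_le_pos; nra).
      assert (0 <= (- a * s) * (/ Rmax (U s) m - / M)) by (apply Rmult_le_pos; nra).
      nra. }
  unfold U in H at 1. rewrite flow_initial in H by exact m_pos.
  unfold displacement in HD. fold U in HD.
  assert (a / (2 * M) < - k).
  { apply Rmult_lt_reg_r with (2 * M); [lra|].
    replace (a / (2 * M) * (2 * M)) with a by (field; lra). lra. }
  simpl in H. lra.
Qed.

(** The deformation argument: [S] collects the opposites of the parameters for
    which the displacement is still positive somewhere between [p] and [q], so
    [a1] is the infimum of these parameters. *)
Lemma no_positive_displacement (a p q y : R) :
  closed_start m a b p -> closed_start m a b q -> p <= y <= q ->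
  displacement m a b y <= 0.
Proof.
  intros [Ap Zp] [Aq Zq] Hy. apply Rnot_lt_le. intros HD.
  assert (Pp : m < p) by (specialize (Ap 0); rewrite flow_initial in Ap; assumption).
  set (S := fun c => - c <= a /\ exists z, p <= z <= q /\ 0 < displacement m (- c) b z).
  destruct (completeness S) as [c [Ub Lub]].
  - destruct (positive_displacement_parameter_bound q) as [c Hc].
    exists (- c). intros c' [_ [z [Hz Dz]]].
    specialize (Hc (- c') z ltac:(lra) Dz). lra.
  - exists (- a). split; [lra|]. exists y. split; [exact Hy|]. now rewrite Ropp_involutive.
  - set (a1 := - c).
    assert (Min : forall a' z, a' <= a -> p <= z <= q -> 0 < displacement m a' b z -> a1 <= a').
    { intros a' z Ha' Hz Dz. unfold a1. enough (- a' <= c) by lra.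
      apply Ub. split; [lra|]. exists z. split; [exact Hz|]. now rewrite Ropp_involutive. }
    assert (Le : a1 <= a) by (apply (Min a y); auto; lra).
    destruct (displacement_lipschitz a1) as [C [PC HC]].
    assert (Npos : forall z, p <= z <= q -> displacement m a1 b z <= 0).
    { intros z Hz. apply Rnot_lt_le. intros Dz.
      set (d := displacement m a1 b z / (2 * C)).
      assert (Pd : 0 < d) by (apply Rdiv_lt_0_compat; lra).
      specialize (HC (a1 - d) z). replace (a1 - d - a1) with (- d) in HC by ring.
      rewrite Rabs_Ropp, (Rabs_pos_eq d) in HC by lra.
      apply Rabs_le_between in HC.
      assert (C * d = displacement m a1 b z / 2) by (unfold d; field; lra).
      specialize (Min (a1 - d) z ltac:(lra) Hz ltac:(lra)). lra. }
    assert (Lt : a1 < a).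
    { destruct Le as [|E]; [assumption|]. specialize (Npos y Hy). rewrite E in Npos. lra. }
    destruct (continuity_ab_maj (displacement m a1 b) p q) as [z [Hmax Hz]]; [lra | |].
    { intros s _. apply continuity_pt_filterlim, continuous_displacement, m_pos. }
    (* were the maximum negative, it would stay so for slightly larger
       parameters, and a1 would not be the infimum *)
    assert (Zz : displacement m a1 b z = 0).
    { specialize (Npos z Hz). destruct Npos as [Neg|]; [exfalso|assumption].
      set (d := - displacement m a1 b z / C).
      assert (Pd : 0 < d) by (apply Rdiv_lt_0_compat; lra).
      assert (c <= c - d); [|lra].
      apply Lub. intros c' [Hc' [s [Hs Ds]]].
      assert (a1 <= - c') by (unfold a1; pose proof (Ub c'
        (conj Hc' (ex_intro _ s (conj Hs Ds)))); lra).
      specialize (HC (- c') s). rewrite (Rabs_pos_eq (- c' - a1)) in HC by lra.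
      apply Rabs_le_between in HC. specialize (Hmax s Hs).
      assert (- displacement m a1 b z < C * (- c' - a1)) by lra.
      assert (d < - c' - a1).
      { apply Rmult_lt_reg_l with C; [exact PC|].
        replace (C * d) with (- displacement m a1 b z) by (unfold d; field; lra). assumption. }
      unfold a1 in *. lra. }
    assert (p < z < q).
    { pose proof (displacement_increasing a1 a p Lt). pose proof (displacement_increasing a1 a q Lt).
      split; apply Rnot_le_lt; intros Hle.
      - assert (z = p) by lra. subst z. lra.
      - assert (z = q) by lra. subst z. lra. }
    apply (no_interior_maximum m a1 b m_pos p z q); auto.
    (* the trajectory from p at the original parameter keeps the touching
       solution away from the truncation *)
    intros t. apply Rlt_le_trans with (flow m a b p (clamp t)); [apply Ap|].
    rewrite <- (flow_clamp m a1 b m_pos z).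
    apply flow_barrier; [lra | exact Ap | | apply clamp_range].
    unfold displacement in Zp, Zz. lra.
Qed.

Lemma no_three_closed (a p y q : R) :
  closed_start m a b p -> closed_start m a b y -> closed_start m a b q -> p < y < q -> False.
Proof.
  intros Hp [Ay Zy] Hq Hy.
  apply (no_interior_maximum m a b m_pos p y q Ay Hy Zy).
  intros z Hz. now apply (no_positive_displacement a p q).
Qed.

Lemma no_singular_pair (a y z : R) :
  closed_start m a b y -> closed_start m a b z -> y <> z -> exponent m a b y <> 0.
Proof.
  intros Hy Hz Hne Sing. pose proof Hy as [Ay Zy].
  destruct (singular_bump m a b m_pos y Ay Zy Sing) as [d [Pd Hd]].
  pose proof (Rmin_l (d / 2) (Rabs (z - y))). pose proof (Rmin_r (d / 2) (Rabs (z - y))).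
  assert (Pr : 0 < Rmin (d / 2) (Rabs (z - y)))
    by (apply Rmin_glb_lt; [lra | apply Rabs_pos_lt; lra]).
  set (r := Rmin (d / 2) (Rabs (z - y))) in *.
  destruct (Rtotal_order y z) as [Hlt|[E|Hgt]]; [|contradiction|].
  - rewrite Rabs_pos_eq in * by lra.
    pose proof (no_positive_displacement a y z (y + r) Hy Hz ltac:(lra)).
    specialize (Hd (y + r)). replace (y + r - y) with r in Hd by ring.
    rewrite (Rabs_pos_eq r) in Hd by lra. specialize (Hd ltac:(lra) ltac:(lra)). lra.
  - rewrite Rabs_left1 in * by lra.
    pose proof (no_positive_displacement a z y (y - r) Hz Hy ltac:(lra)).
    specialize (Hd (y - r)). replace (y - r - y) with (- r) in Hd by ring.
    rewrite Rabs_Ropp, (Rabs_pos_eq r) in Hd by lra. specialize (Hd ltac:(lra) ltac:(lra)). lra.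
Qed.

End Rotation.

Lemma flow_of_trajectory (m a b : R) (u : R -> R) (t : R) : 0 < m ->
  trajectory a b u -> (forall t, m < u (clamp t)) -> flow m a b (u 0) t = u (clamp t).
Proof.
  intros Hm Hu Habove.
  pose proof (trajectory_flow m a b _ (clamp t) Hm (trajectory_clamp a b u Hu)) as E.
  cbv beta in E. rewrite (clamp_id 0), (clamp_id (clamp t)), flow_clamp in E
    by (try apply clamp_range; lra).
  apply E; [|apply clamp_range]. intros s. now apply Rlt_le.
Qed.

(** All sufficiently small truncation levels serve, so that a common level can
    be chosen for several closed solutions. *)
Lemma closed_trajectory_start (a b : R) (u : R -> R) : closed_trajectory a b u ->
  exists m0, 0 < m0 /\ forall m, 0 < m <= m0 -> closed_start m a b (u 0).
Proof.
  intros [Hu E]. destruct (trajectory_lower_bound a b u Hu) as [m0 [Pm Hm]].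
  exists m0. split; [exact Pm|]. intros m Hmm.
  assert (F : forall t, flow m a b (u 0) t = u (clamp t)).
  { intros t. apply flow_of_trajectory; [lra | exact Hu |].
    intros s; specialize (Hm s); lra. }
  split.
  - intros t. rewrite F. specialize (Hm t). lra.
  - unfold displacement. rewrite F, clamp_id by lra. lra.
Qed.

Lemma positive_closed_start (a b x : R) : positive_closed a b x ->
  exists m0, 0 < m0 /\ forall m, 0 < m <= m0 -> closed_start m a b (/ x).
Proof.
  intros H. apply positive_closed_iff in H as [Hx [u [Hu <-]]].
  now apply closed_trajectory_start.
Qed.

Lemma closed_start_positive_closed (m a b y : R) : 0 < m ->
  closed_start m a b y -> positive_closed a b (/ y).
Proof.
  intros Hm [Ay Zy].
  assert (Py : m < y) by (specialize (Ay 0); rewrite flow_initial in Ay; assumption).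
  apply positive_closed_iff. split; [apply Rinv_0_lt_compat; lra|].
  exists (flow m a b y). split; [now apply flow_closed_trajectory|].
  now rewrite flow_initial, Rinv_inv.
Qed.

(** * Multiplicities *)

Section Multiplicity.
Variables m a b x : R.
Hypothesis m_pos : 0 < m.
Hypothesis x_pos : 0 < x.
Hypothesis x_closed : closed_start m a b (/ x).

Let U (y : R) := flow m a b y 1.
Let Phi (y : R) := exp (exponent m a b y).
(* derivative of [z |-> / U (/ z) - z], as a function of [y = / z] *)
Let G (y : R) := Phi y * (y * / U y) ^ 2 - 1.

Lemma near_start : locally x (fun z => 0 < z /\ forall t, m < flow m a b (/ z) t).
Proof.
  destruct x_closed as [A _].
  destruct (flow_stays_above a b m m_pos (/ x) A) as [d [Pd Hd]].
  assert (C : continuous Rinv x)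
    by (apply (ex_derive_continuous Rinv); auto_derive; lra).
  pose proof (C (fun y => Rabs (y - / x) < d)) as L.
  apply filter_and.
  - exists (mkposreal x x_pos). intros z Hz. apply Rabs_def2 in Hz.
    unfold minus, plus, opp in Hz; simpl in Hz. lra.
  - apply (filter_imp (fun z => Rabs (/ z - / x) < d)).
    + intros z Hz. now apply Hd.
    + apply L. exists (mkposreal d Pd). intros z Hz. exact Hz.
Qed.

Lemma abel_flow_eq (z : R) : 0 < z -> (forall t, m < flow m a b (/ z) t) ->
  abel_flow a b 1 z = / U (/ z).
Proof.
  intros Hz A.
  rewrite <- (Rinv_inv z) at 1. rewrite <- (flow_initial m a b m_pos (/ z)) at 1.
  apply abel_flow_trajectory. apply flow_trajectory; [exact m_pos|].
  intros t; now apply Rlt_le.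
Qed.

Lemma return_map_derive (z : R) : 0 < z -> (forall t, m < flow m a b (/ z) t) ->
  is_derive (fun z => / U (/ z) - z) z (G (/ z)).
Proof.
  intros Hz A. pose proof (A 1) as A1.
  apply is_derive_eq with (- (- / z ^ 2 * Phi (/ z)) / U (/ z) ^ 2 - 1).
  - apply (is_derive_minus (fun z => / U (/ z)) (fun z => z)).
    + apply (is_derive_inv (fun z => U (/ z))).
      * apply (is_derive_comp U Rinv); [now apply flow_derive|].
        apply is_derive_eq with (- 1 / z ^ 2); [|field; lra].
        apply (is_derive_inv (fun z => z)); [apply (is_derive_id (K := R_AbsRing)) | lra].
      * unfold U. lra.
    + apply (is_derive_id (K := R_AbsRing)).
  - unfold G. fold (U (/ z)) in A1. field. lra.
Qed.

Lemma abel_return_derive : locally x (fun z =>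
  is_derive (fun y => abel_flow a b 1 y - y) z (G (/ z))).
Proof.
  apply (filter_imp (fun z => locally z (fun z => 0 < z /\ forall t, m < flow m a b (/ z) t))).
  - intros z Hz. destruct (locally_singleton _ _ Hz) as [Pz Az].
    apply (is_derive_ext_loc (fun z => / U (/ z) - z)); [|now apply return_map_derive].
    revert Hz. apply filter_imp. intros r [Pr Ar]. now rewrite abel_flow_eq.
  - apply (locally_locally x), near_start.
Qed.

Lemma U_fixed : U (/ x) = / x.
Proof. destruct x_closed as [_ Z]. unfold displacement in Z. unfold U. lra. Qed.

Lemma abel_flow_fixed : abel_flow a b 1 x - x = 0.
Proof.
  destruct (locally_singleton _ _ near_start) as [_ A].
  rewrite abel_flow_eq, U_fixed, Rinv_inv by assumption. ring.
Qed.

Lemma G_closed : G (/ x) = Phi (/ x) - 1.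
Proof. unfold G. rewrite U_fixed. field. lra. Qed.

Lemma simple_multiplicity : exponent m a b (/ x) <> 0 -> closed_multiplicity a b x 1.
Proof.
  intros Hne. split.
  - intros j Hj. replace j with 0%nat by lia. exact abel_flow_fixed.
  - exists (Phi (/ x) - 1). split.
    + unfold Phi. rewrite <- exp_0. intros E. apply Hne, exp_inv. lra.
    + rewrite <- G_closed. exact (locally_singleton _ _ abel_return_derive).
Qed.

(** In the coordinate [1 / x] the second derivative of the displacement is the
    slope of the exponent, which is nonzero; the change of coordinate multiplies
    it by [- 1 / x^2]. *)
Lemma double_multiplicity : exponent m a b (/ x) = 0 -> closed_multiplicity a b x 2.
Proof.
  intros Sing. destruct x_closed as [A Z].
  assert (P1 : Phi (/ x) = 1) by (unfold Phi; now rewrite Sing, exp_0).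
  assert (Px : 0 < / x) by now apply Rinv_0_lt_compat.
  split.
  - intros j Hj. destruct j as [|[|j]]; [exact abel_flow_fixed | | lia].
    replace 0 with (G (/ x)) by (rewrite G_closed, P1; ring).
    exact (locally_singleton _ _ abel_return_derive).
  - set (l := exponent_slope m a b (/ x)).
    pose proof (exponent_slope_pos m a b m_pos (/ x) A Z Sing) as Pl. fold l in Pl.
    exists (- / x ^ 2 * l). split.
    { pose proof (Rinv_0_lt_compat _ (pow_lt x 2 x_pos)). nra. }
    apply (is_derive_ext_loc (fun z => G (/ z))).
    { generalize abel_return_derive. apply filter_imp.
      intros z Hz. symmetry. now apply is_derive_unique. }
    apply (is_derive_comp G Rinv).
    + (* y / U y is stationary at / x, where U has value / x and slope 1, so only
         the derivative l of the exponent survives *)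
      apply is_derive_eq with
        (l * Phi (/ x) * (/ x * / U (/ x)) ^ 2
         + Phi (/ x) * ((1 * / U (/ x) + / x * (- Phi (/ x) / U (/ x) ^ 2))
                        * (2 * (/ x * / U (/ x)))) - 0).
      * apply (is_derive_minus (fun y => Phi y * (y * / U y) ^ 2) (fun _ => 1)).
        2: apply (is_derive_const (V := R_NormedModule) 1).
        apply (is_derive_mult Phi (fun y => (y * / U y) ^ 2)).
        -- apply (is_derive_comp exp (exponent m a b)); [apply is_derive_exp|].
           now apply exponent_derive.
        -- apply (is_derive_comp (fun s => s ^ 2) (fun y => y * / U y)).
           { auto_derive; [trivial | ring]. }
           apply (is_derive_mult (fun y => y) (fun y => / U y)).
           ++ apply (is_derive_id (K := R_AbsRing)).
           ++ apply (is_derive_inv U); [now apply flow_derive|]. rewrite U_fixed; lra.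
           ++ intros; apply Rmult_comm.
        -- intros; apply Rmult_comm.
      * rewrite U_fixed, P1. field. lra.
    + apply is_derive_eq with (- 1 / x ^ 2); [|field; lra].
      apply (is_derive_inv (fun z => z)); [apply (is_derive_id (K := R_AbsRing)) | lra].
Qed.

End Multiplicity.

(** * At most two positive closed solutions *)

Lemma positive_closed_multiplicity (a b x : R) : positive_closed a b x ->
  closed_multiplicity a b x 1 \/ closed_multiplicity a b x 2.
Proof.
  intros H. pose proof H as [Hx _].
  destruct (positive_closed_start a b x H) as [m [Pm Hm]].
  specialize (Hm m ltac:(lra)).
  destruct (Req_dec (exponent m a b (/ x)) 0).
  - right. now apply (double_multiplicity m).
  - left. now apply (simple_multiplicity m).
Qed.

Lemma positive_closed_pair_simple (a b x x' : R) :
  positive_closed a b x -> positive_closed a b x' -> x <> x' ->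
  closed_multiplicity a b x 1.
Proof.
  intros H H' Hne. pose proof H as [Hx _]. pose proof H' as [Hx' _].
  destruct (positive_closed_start a b x H) as [m1 [P1 H1]].
  destruct (positive_closed_start a b x' H') as [m2 [P2 H2]].
  pose proof (Rmin_l m1 m2); pose proof (Rmin_r m1 m2).
  assert (Pm : 0 < Rmin m1 m2) by now apply Rmin_glb_lt.
  specialize (H1 (Rmin m1 m2) ltac:(lra)). specialize (H2 (Rmin m1 m2) ltac:(lra)).
  apply (simple_multiplicity (Rmin m1 m2)); auto.
  apply (no_singular_pair (Rmin m1 m2) b Pm a (/ x) (/ x')); auto.
  intros E. apply Hne. now apply Rinv_eq_reg.
Qed.

Lemma positive_closed_triple (a b x y z : R) :
  positive_closed a b x -> positive_closed a b y -> positive_closed a b z ->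
  x < y < z -> False.
Proof.
  intros Hx Hy Hz Hlt. pose proof Hx as [Px _].
  destruct (positive_closed_start a b x Hx) as [m1 [P1 H1]].
  destruct (positive_closed_start a b y Hy) as [m2 [P2 H2]].
  destruct (positive_closed_start a b z Hz) as [m3 [P3 H3]].
  set (m := Rmin m1 (Rmin m2 m3)).
  pose proof (Rmin_l m1 (Rmin m2 m3)); pose proof (Rmin_r m1 (Rmin m2 m3)).
  pose proof (Rmin_l m2 m3); pose proof (Rmin_r m2 m3). fold m in H, H0.
  assert (Pm : 0 < m) by (repeat apply Rmin_glb_lt; assumption).
  specialize (H1 m ltac:(lra)). specialize (H2 m ltac:(lra)). specialize (H3 m ltac:(lra)).
  apply (no_three_closed m b Pm a (/ z) (/ y) (/ x) H3 H2 H1).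
  split; apply Rinv_lt_contravar; try lra; apply Rmult_lt_0_compat; lra.
Qed.

Lemma at_most_two (a b : R) :
  exists n : nat, positive_closed_count a b n /\ (n <= 2)%nat.
Proof.
  destruct (classic (exists x, positive_closed a b x)) as [[x Hx]|None].
  2: { exists 0%nat. split; [|lia]. exists nil, (fun _ => 0%nat).
       split; [constructor|]. split; [|split; [intros ? []|reflexivity]].
       intros x. split; [intros []|]. intros Hx. apply None. now exists x. }
  destruct (classic (exists x', positive_closed a b x' /\ x <> x')) as [[x' [Hx' Hne]]|One].
  - exists 2%nat. split; [|lia]. exists (x :: x' :: nil), (fun _ => 1%nat).
    split; [|split; [|split; [|reflexivity]]].
    + constructor; [intros [E|[]]; now apply Hne | constructor; [intros []|constructor]].
    + intros z. split; [intros [<-|[<-|[]]]; assumption|]. intros Hz.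
      destruct (Req_dec x z) as [|N1]; [now left|].
      destruct (Req_dec x' z) as [|N2]; [right; now left|]. exfalso.
      destruct (Rtotal_order x x') as [L|[L|L]], (Rtotal_order x z) as [L1|[L1|L1]],
        (Rtotal_order x' z) as [L2|[L2|L2]]; try lra; unfold Rgt in *;
      match goal with
      | A : ?p < ?q, B : ?q < ?r |- _ =>
          apply (positive_closed_triple a b p q r); auto; fail
      end.
    + intros z [<-|[<-|[]]].
      * now apply (positive_closed_pair_simple a b x x').
      * apply (positive_closed_pair_simple a b x' x); auto.
  - assert (Only : forall k, closed_multiplicity a b x k -> positive_closed_count a b k).
    { intros k Hk. exists (x :: nil), (fun _ => k).
      split; [constructor; [intros []|constructor]|]. split; [|split].
      - intros z. split; [intros [<-|[]]; exact Hx|]. intros Hz. left.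
        destruct (Req_dec x z) as [|N]; [assumption|]. exfalso. apply One. now exists z.
      - intros z [<-|[]]. exact Hk.
      - simpl. lia. }
    destruct (positive_closed_multiplicity a b x Hx) as [H1|H2].
    + exists 1%nat. split; [now apply Only | lia].
    + exists 2%nat. split; [now apply Only | lia].
Qed.

(** * Solutions far from the singularity and sharpness *)

Lemma increment_bound (f df : R -> R) (M t : R) :
  0 <= t <= 1 -> (forall s, continuous f s) ->
  (forall s, 0 < s < 1 -> is_derive f s (df s)) ->
  (forall s, 0 < s < 1 -> Rabs (df s) <= M) -> Rabs (f t - f 0) <= M.
Proof.
  intros Ht Hc Hd HM.
  assert (PM : 0 <= M)
    by (eapply Rle_trans; [apply Rabs_pos | apply (HM (1 / 2)); lra]).
  destruct (Req_dec t 0) as [->|Hn]; [rewrite Rminus_diag, Rabs_R0; exact PM|].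
  destruct (mean_value f df 0 t) as [c [Hc' ->]]; auto; try lra.
  { intros; apply Hd; lra. }
  rewrite Rabs_mult, (Rabs_pos_eq (t - 0)) by lra.
  specialize (HM c ltac:(lra)). pose proof (Rabs_pos (df c)). nra.
Qed.

Definition primA (a t : R) : R := t ^ 3 / 3 - a * t ^ 2 / 2.
Definition primB (b t : R) : R := t ^ 3 / 3 - (1 + b) * t ^ 2 / 2 + b * t.
(** The primitive of [coefA a * primB b] that vanishes at [0]. *)
Definition primAB (a b t : R) : R :=
  t ^ 6 / 18 - (1 + b) * t ^ 5 / 10 + b * t ^ 4 / 4
  - a * t ^ 5 / 15 + a * (1 + b) * t ^ 4 / 8 - a * b * t ^ 3 / 3.

Section LargeStart.
Variables a b y : R.
Hypothesis a_range : 0 <= a <= 1.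
Hypothesis b_range : 0 <= b <= 1.
Hypothesis y_large : 4 <= y.

Let U := flow 1 a b y.

Lemma coefA_unit (t : R) : 0 <= t <= 1 -> Rabs (coefA a t) <= 1.
Proof. intros Ht. unfold coefA. apply Rabs_le. nra. Qed.

Lemma coefB_unit (t : R) : 0 <= t <= 1 -> Rabs (coefB b t) <= 1.
Proof. intros Ht. unfold coefB. apply Rabs_le. nra. Qed.

Lemma primB_unit (t : R) : 0 <= t <= 1 -> Rabs (primB b t) <= 1.
Proof.
  intros Ht. replace (primB b t) with (primB b t - primB b 0) by (unfold primB; field).
  apply (increment_bound (primB b) (coefB b)); auto.
  - intros s. apply (ex_derive_continuous (primB b)). unfold primB. auto_derive; trivial.
  - intros s _. unfold primB, coefB. auto_derive; [trivial | field].
  - intros s Hs. apply coefB_unit; lra.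
Qed.

Lemma large_flow_near (t : R) : Rabs (U t - y) <= 2.
Proof.
  destruct (flow_solves 1 a b Rlt_0_1 y) as [C D]. fold U in C, D.
  pose proof (flow_clamp 1 a b Rlt_0_1 y t) as E. fold U in E. rewrite <- E.
  pose proof (flow_initial 1 a b Rlt_0_1 y) as E0. fold U in E0.
  replace (U (clamp t) - y) with (U (clamp t) - U 0) by (now rewrite E0).
  apply (increment_bound U (fun s => truncated_field 1 a b s (U s))); auto.
  - apply clamp_range.
  - intros s Hs. unfold truncated_field.
    pose proof (coefA_unit s ltac:(lra)). pose proof (coefB_unit s ltac:(lra)).
    pose proof (Rinv_Rmax_bound 1 (U s) Rlt_0_1) as Q. rewrite Rinv_1 in Q.
    eapply Rle_trans; [apply Rabs_triang|]. rewrite Rabs_Ropp.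
    unfold Rdiv. rewrite Rabs_mult, Rabs_Ropp, (Rabs_pos_eq (/ _)) by lra.
    pose proof (Rabs_pos (coefA a s)). nra.
Qed.

(** With [y >= 4] the solution stays at least [2], so truncation at level [1] is
    invisible. *)
Lemma large_flow_above (t : R) : 1 < U t.
Proof. pose proof (large_flow_near t) as E. apply Rabs_le_between in E. lra. Qed.

Lemma large_flow_derive (t : R) : 0 < t < 1 ->
  is_derive U t (- coefA a t / U t - coefB b t).
Proof.
  intros Ht. destruct (flow_solves 1 a b Rlt_0_1 y) as [C D]. fold U in C, D.
  specialize (D t Ht). unfold truncated_field in D.
  rewrite Rmax_left in D by (pose proof (large_flow_above t); lra). exact D.
Qed.

(** The term [A / u] of the field is of order [1 / y], so to leading order [u] is
    [y] minus the primitive of [B]. *)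
Lemma large_flow_first_order (t : R) : 0 <= t <= 1 ->
  Rabs (U t - y + primB b t) <= 2 / y.
Proof.
  intros Ht. destruct (flow_solves 1 a b Rlt_0_1 y) as [C _]. fold U in C.
  pose proof (flow_initial 1 a b Rlt_0_1 y) as E0. fold U in E0.
  replace (U t - y + primB b t) with ((U t + primB b t) - (U 0 + primB b 0))
    by (rewrite E0; unfold primB; field).
  apply (increment_bound (fun t => U t + primB b t) (fun t => - coefA a t / U t)); auto.
  - intros s. apply (continuous_plus U (primB b)); [apply C|].
    apply (ex_derive_continuous (primB b)). unfold primB. auto_derive; trivial.
  - intros s Hs. apply is_derive_eq with ((- coefA a s / U s - coefB b s) + coefB b s); [|ring].
    apply (is_derive_plus U (primB b)); [now apply large_flow_derive|].
    unfold primB, coefB. auto_derive; [trivial | field].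
  - intros s Hs. pose proof (coefA_unit s ltac:(lra)) as EA.
    pose proof (large_flow_near s) as E. apply Rabs_le_between in E.
    unfold Rdiv. rewrite Rabs_mult, Rabs_Ropp.
    assert (P : 0 < / U s) by (apply Rinv_0_lt_compat; lra).
    assert (Q : / U s <= 2 * / y).
    { replace (2 * / y) with (/ (y / 2)) by (field; lra). apply Rinv_le_contravar; lra. }
    rewrite (Rabs_pos_eq (/ U s)) by lra.
    pose proof (Rabs_pos (coefA a s)). nra.
Qed.

(** Inserting the first-order approximation of [u] into [A / u] gives
    [A / y + A primB / y^2] up to [O (y^-3)]. *)
Lemma large_displacement :
  Rabs (displacement 1 a b y + primB b 1 + primA a 1 / y + primAB a b 1 / y ^ 2) <= 8 / y ^ 3.
Proof.
  destruct (flow_solves 1 a b Rlt_0_1 y) as [C _]. fold U in C.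
  pose proof (flow_initial 1 a b Rlt_0_1 y) as E0. fold U in E0.
  unfold displacement. fold (U 1).
  set (F := fun t => U t + (primB b t + primA a t / y + primAB a b t / y ^ 2)).
  replace (U 1 - y + primB b 1 + primA a 1 / y + primAB a b 1 / y ^ 2) with (F 1 - F 0)
    by (unfold F; rewrite E0; unfold primA, primB, primAB; field; lra).
  apply (increment_bound F (fun t => - coefA a t * (/ U t - / y - primB b t / y ^ 2))); [lra | | |].
  - intros s. apply (continuous_plus U); [apply C|].
    apply (ex_derive_continuous (fun t => primB b t + primA a t / y + primAB a b t / y ^ 2)).
    unfold primA, primB, primAB. auto_derive; trivial.
  - intros s Hs.
    apply is_derive_eq with ((- coefA a s / U s - coefB b s)
      + (coefB b s + coefA a s / y + coefA a s * primB b s / y ^ 2)); [|unfold Rdiv; ring].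
    apply (is_derive_plus U); [now apply large_flow_derive|].
    unfold primA, primB, primAB, coefA, coefB. auto_derive; [trivial | field; lra].
  - intros s Hs. pose proof (coefA_unit s ltac:(lra)) as EA.
    pose proof (large_flow_near s) as E. pose proof (large_flow_first_order s ltac:(lra)) as E1.
    pose proof (primB_unit s ltac:(lra)) as EB.
    set (r := U s - y + primB b s) in *.
    assert (PU : y / 2 <= U s) by (apply Rabs_le_between in E; lra).
    replace (- coefA a s * (/ U s - / y - primB b s / y ^ 2))
      with (coefA a s * (primB b s * (U s - y) + r * y) * / (y ^ 2 * U s))
      by (unfold r; field; lra).
    assert (P2 : 0 < y ^ 2) by (apply pow_lt; lra).
    assert (I1 : 0 < / (y ^ 2 * U s))
      by (apply Rinv_0_lt_compat, Rmult_lt_0_compat; lra).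
    assert (I2 : / (y ^ 2 * U s) <= 2 / y ^ 3).
    { replace (2 / y ^ 3) with (/ (y ^ 2 * (y / 2))) by (field; lra).
      apply Rinv_le_contravar; [apply Rmult_lt_0_compat; lra | nra]. }
    rewrite !Rabs_mult, (Rabs_pos_eq (/ _)) by lra.
    assert (N : Rabs (primB b s * (U s - y) + r * y) <= 4).
    { eapply Rle_trans; [apply Rabs_triang|]. rewrite !Rabs_mult, (Rabs_pos_eq y) by lra.
      assert (Rabs r * y <= 2).
      { replace 2 with (2 / y * y) by (field; lra). apply Rmult_le_compat_r; lra. }
      pose proof (Rabs_pos (primB b s)). pose proof (Rabs_pos (U s - y)). nra. }
    replace (8 / y ^ 3) with (1 * 4 * (2 / y ^ 3)) by (field; lra).
    apply Rmult_le_compat; [| lra | | exact I2].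
    + apply Rmult_le_pos; apply Rabs_pos.
    + apply Rmult_le_compat; try apply Rabs_pos; assumption.
Qed.

End LargeStart.

Lemma displacement_zero_between (a b p q : R) :
  0 <= a <= 1 -> 0 <= b <= 1 -> 4 <= p -> p <= q ->
  Rmin (displacement 1 a b p) (displacement 1 a b q) <= 0
    <= Rmax (displacement 1 a b p) (displacement 1 a b q) ->
  exists y, p <= y <= q /\ displacement 1 a b y = 0 /\ positive_closed a b (/ y).
Proof.
  intros Ha Hb Hp Hpq H0.
  destruct (IVT_gen (displacement 1 a b) p q 0) as [y [Hy Z]]; [|exact H0|].
  { intros s. apply continuity_pt_filterlim, continuous_displacement, Rlt_0_1. }
  rewrite Rmin_left, Rmax_right in Hy by lra.
  exists y. split; [exact Hy|]. split; [exact Z|].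
  apply (closed_start_positive_closed 1); [lra|]. split; [|exact Z].
  intros t. apply large_flow_above; lra.
Qed.

(** With [y = 3 10^7 s], the chosen parameters make the displacement
    [(1 - 3 / s + 1 / s^2) / 540], up to the factor [(3 10^7)^-2] and small
    errors; the values of this expression at [s = 1/3, 1, 3] alternate in sign. *)
Lemma two_positive_closed : exists tA tB x1 x2 : R,
  x1 <> x2 /\ positive_closed tA tB x1 /\ positive_closed tA tB x2.
Proof.
  set (a := 2 / 3 - / (270 * 10 ^ 7)). set (b := 1 / 3 - / (2430 * 10 ^ 14)).
  assert (Ha : 0 <= a <= 1) by (unfold a; lra).
  assert (Hb : 0 <= b <= 1) by (unfold b; lra).
  pose proof (large_displacement a b (10 ^ 7) Ha Hb ltac:(lra)) as D1.
  pose proof (large_displacement a b (3 * 10 ^ 7) Ha Hb ltac:(lra)) as D2.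
  pose proof (large_displacement a b (9 * 10 ^ 7) Ha Hb ltac:(lra)) as D3.
  apply Rabs_le_between in D1. apply Rabs_le_between in D2. apply Rabs_le_between in D3.
  unfold primA, primB, primAB in D1, D2, D3.
  assert (S1 : 0 < displacement 1 a b (10 ^ 7)).
  { revert D1. generalize (displacement 1 a b (10 ^ 7)). unfold a, b. intros; lra. }
  assert (S2 : displacement 1 a b (3 * 10 ^ 7) < 0).
  { revert D2. generalize (displacement 1 a b (3 * 10 ^ 7)). unfold a, b. intros; lra. }
  assert (S3 : 0 < displacement 1 a b (9 * 10 ^ 7)).
  { revert D3. generalize (displacement 1 a b (9 * 10 ^ 7)). unfold a, b. intros; lra. }
  destruct (displacement_zero_between a b (10 ^ 7) (3 * 10 ^ 7) Ha Hb) as [y1 [R1 [Z1 P1]]];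
    [lra | lra | rewrite Rmin_right, Rmax_left; lra |].
  destruct (displacement_zero_between a b (3 * 10 ^ 7) (9 * 10 ^ 7) Ha Hb) as [y2 [R2 [_ P2]]];
    [lra | lra | rewrite Rmin_left, Rmax_right; lra |].
  exists a, b, (/ y1), (/ y2). split; [|split; assumption].
  intros E. apply Rinv_eq_reg in E. subst y2.
  assert (Y : y1 = 3 * 10 ^ 7) by (clear - R1 R2; apply Rle_antisym; lra).
  rewrite <- Y, Z1 in S2. exact (Rlt_irrefl 0 S2).
Qed.

(** * The bound and its sharpness *)

Theorem theorem1p3 :
  (forall tA tB : R,
     exists n : nat, positive_closed_count tA tB n /\ (n <= 2)%nat) /\
  (exists tA tB x1 x2 : R,
     x1 <> x2 /\ positive_closed tA tB x1 /\ positive_closed tA tB x2).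
Proof. exact (conj at_most_two two_positive_closed). Qed.
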